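(* For every integer $n\ge 1$, $\zeta(2n+1)/\pi^{2n}$ is an exponential period over the field $\mathbb{Q}(t,e^{-t})$. More precisely, $$\frac{\zeta(2n+1)}{\pi^{2n}}=(-1)^n2^{2n+1}\left(\int_0^{+\infty}\frac{1}{t^{2n}}\left(\frac{1}{1-e^{-t}}-\sum_{k=-1}^{2n}b_kt^k\right)\frac{e^{-t}\,dt}{t}+c_n\right),$$ where $c_n\in\mathbb{Q}$ is given by $$c_n=\sum_{\ell=1}^{2n+1}b_{2n-\ell}\frac{(-1)^\ell}{\ell!}H_\ell.$$
   Context: $\zeta$ is the Riemann zeta function and $H_\ell=1+\frac12+\cdots+\frac1\ell$. The rational numbers $b_k$ ($k\ge-1$) are defined by the Laurent expansion at $t=0$: $\frac{1}{1-e^{-t}}=\sum_{k\ge-1}b_kt^k=\frac1t+\frac12+\frac1{12}t-\frac1{720}t^3+\cdots$. $\mathbb{Q}(t,e^{-t})$ is the field of meromorphic functions of $t$ generated over $\mathbb{Q}$ by $t$ and $e^{-t}$. A complex number is an exponential period over a field $\mathbb{F}$ of meromorphic functions of $t$ if it equals a convergent integral $\int_0^{+\infty}f(t)\,dt$ with $f\in\mathbb{F}$. *)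

(* Defs.v *)
From Stdlib Require Import Reals Arith ZArith QArith Qpower Qreals List Factorial Wf_nat Lra Lia.
From Coquelicot Require Import Coquelicot.

Open Scope R_scope.

(* The Riemann zeta function on the half-line s > 1. *)
Definition zeta (s : R) : R := Series (fun k : nat => Rpower (INR (S k)) (- s)).

Definition Cexp (z : C) : C :=
  (exp (Re z) * cos (Im z), exp (Re z) * sin (Im z)).

(* A meromorphic function is represented by a total function [C -> C].  Field
   operations are taken pointwise and [Cinv 0 = 0], so a member below may differ
   from the meromorphic function it stands for, but only on a closed discrete set;
   likewise the inverse of a representative of 0 is a representative of 0.
   Since such sets are finite on compact intervals, this does not affect
   (improper Riemann) integrals. *)
Inductive generated_field (G : (C -> C) -> Prop) : (C -> C) -> Prop :=
| gf_gen f : G f -> generated_field G f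
| gf_rat (q : Q) : generated_field G (fun _ => RtoC (Q2R q))
| gf_add f g : generated_field G f -> generated_field G g ->
    generated_field G (fun t => Cplus (f t) (g t))
| gf_opp f : generated_field G f -> generated_field G (fun t => Copp (f t))
| gf_mul f g : generated_field G f -> generated_field G g ->
    generated_field G (fun t => Cmult (f t) (g t))
| gf_inv f : generated_field G f -> generated_field G (fun t => Cinv (f t)).

(* The field Q(t, e^{-t}). *)
Definition Q_t_expNt : (C -> C) -> Prop :=
  generated_field (fun f => f = (fun t => t) \/ f = (fun t => Cexp (Copp t))).

Definition exponential_period (F : (C -> C) -> Prop) (z : C) : Prop :=
  exists f : C -> C, F f /\
    is_RInt_gen (V := C_R_NormedModule) (fun t : R => f (RtoC t))
      (at_right 0) (Rbar_locally p_infty) z.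

(* [1 / (1 - e^{-t}) = sum_{k >= -1} b_k t^k] near 0; the j-th term of the
   series is the one of index k = j - 1, and b_k is irrelevant for k < -1. *)
Definition laurent_coefficients (b : Z -> Q) : Prop :=
  exists r : R, 0 < r /\ forall t : R, 0 < Rabs t < r ->
    is_series
      (fun j : nat => Q2R (b (Z.of_nat j - 1)%Z) * powerRZ t (Z.of_nat j - 1))
      (/ (1 - exp (- t))).

(* [sum_{k = -1}^m b_k t^k] *)
Definition laurent_partial_sum (b : Z -> Q) (m : nat) (t : R) : R :=
  sum_f_R0
    (fun j : nat => Q2R (b (Z.of_nat j - 1)%Z) * powerRZ t (Z.of_nat j - 1))
    (m + 1).

(* [sum_{l = 1}^m f l] *)
Definition Qsum1 (f : nat -> Q) (m : nat) : Q :=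
  fold_right Qplus 0%Q (map f (seq 1 m)).

Definition harmonic (l : nat) : Q :=
  Qsum1 (fun j => / inject_Z (Z.of_nat j))%Q l.

Definition c_const (b : Z -> Q) (n : nat) : Q :=
  Qsum1
    (fun l => b (2 * Z.of_nat n - Z.of_nat l)%Z
              * ((-1) ^ Z.of_nat l / inject_Z (Z.of_nat (fact l)))
              * harmonic l)%Q
    (2 * n + 1).

(* Existence of the Laurent coefficients: invert the power series of
   (1 - e^{-t}) / t, whose coefficients are [qa j = (-1)^j / (j+1)!].
   [qinv_list n] lists the coefficients n, n-1, ..., 0 of the inverse. *)
Definition qa (j : nat) : Q :=
  ((-1) ^ Z.of_nat j / inject_Z (Z.of_nat (fact (S j))))%Q.

Fixpoint qinv_list (n : nat) : list Q :=
  match n with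
  | O => 1%Q :: nil
  | S m =>
      let l := qinv_list m in
      Qopp (fold_right Qplus 0%Q
              (map (fun i => qa (S i) * nth i l 0)%Q (seq 0 (S m)))) :: l
  end.

Definition qinv (n : nat) : Q := hd 0%Q (qinv_list n).

Lemma nth_qinv_list n i : (i <= n)%nat -> nth i (qinv_list n) 0%Q = qinv (n - i).
Proof.
  revert i; induction n as [|n IH]; intros i Hi.
  - replace i with 0%nat by lia; reflexivity.
  - destruct i as [|i]; [reflexivity|].
    change (nth (S i) (qinv_list (S n)) 0%Q) with (nth i (qinv_list n) 0%Q).
    rewrite IH by lia; reflexivity.
Qed.

Lemma Q2R_fold_seq (f : nat -> Q) m n :
  Q2R (fold_right Qplus 0%Q (map f (seq m (S n))))
  = sum_f_R0 (fun i => Q2R (f (m + i)%nat)) n.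
Proof.
  revert m; induction n as [|n IH]; intros m.
  - simpl. rewrite Q2R_plus, Nat.add_0_r. rewrite RMicromega.Q2R_0. ring.
  - change (seq m (S (S n))) with (m :: seq (S m) (S n)).
    cbn [map fold_right]. rewrite Q2R_plus, IH, (decomp_sum _ (S n)) by lia.
    rewrite Nat.add_0_r; f_equal. cbn [pred]. apply sum_eq; intros i _.
    do 2 f_equal; lia.
Qed.

Lemma Q2R_qa j : Q2R (qa j) = (-1) ^ j / INR (fact (S j)).
Proof.
  assert (Hf : ~ (inject_Z (Z.of_nat (fact (S j))) == 0)%Q).
  { unfold Qeq; cbn [Qnum Qden inject_Z]. pose proof (lt_O_fact (S j)). lia. }
  unfold qa. rewrite Q2R_div by exact Hf. f_equal.
  - clear Hf. induction j as [|j IH]; [unfold Q2R; simpl; lra|].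
    rewrite (Qeq_eqR _ ((-1) * (-1) ^ Z.of_nat j)%Q).
    + rewrite Q2R_mult, IH. simpl. unfold Q2R; simpl; lra.
    + rewrite Nat2Z.inj_succ, <- Z.add_1_l, Qpower_plus by discriminate.
      reflexivity.
  - unfold Q2R, inject_Z; cbn [Qnum Qden]. rewrite <- INR_IZR_INZ. field.
Qed.

Lemma qa_bound j : Rabs (Q2R (qa j)) <= (1 / 2) ^ j.
Proof.
  rewrite Q2R_qa. unfold Rdiv at 1. rewrite Rabs_mult, pow_1_abs, Rmult_1_l.
  rewrite Rabs_pos_eq by (left; apply Rinv_0_lt_compat, INR_fact_lt_0).
  replace ((1 / 2) ^ j) with (/ 2 ^ j)
    by (unfold Rdiv; rewrite Rmult_1_l, pow_inv; reflexivity).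
  apply Rinv_le_contravar; [apply pow_lt; lra|].
  induction j as [|j IH]; [simpl; lra|].
  change (fact (S (S j))) with (S (S j) * fact (S j))%nat.
  rewrite mult_INR. cbn [pow]. pose proof (pos_INR j).
  rewrite 2!S_INR. pose proof (pow_lt 2 j). nra.
Qed.

Lemma Q2R_qinv_S n :
  Q2R (qinv (S n))
  = - sum_f_R0 (fun i => Q2R (qa (S i)) * Q2R (qinv (n - i))) n.
Proof.
  unfold qinv at 1; cbn [qinv_list hd]. rewrite Q2R_opp, Q2R_fold_seq. f_equal.
  apply sum_eq; intros i Hi. cbn [Nat.add].
  rewrite Q2R_mult, nth_qinv_list by exact Hi. reflexivity.
Qed.

Lemma qinv_bound n : Rabs (Q2R (qinv n)) <= 1.
Proof.
  induction n as [n IH] using (well_founded_induction lt_wf).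
  destruct n as [|n].
  - unfold qinv, Q2R; simpl. rewrite Rabs_pos_eq; lra.
  - rewrite Q2R_qinv_S, Rabs_Ropp.
    eapply Rle_trans; [apply sum_f_R0_triangle|].
    eapply Rle_trans.
    + apply (sum_Rle _ (fun i => (1 / 2) ^ i * (1 / 2))). intros i Hi.
      rewrite Rabs_mult. pose proof (qa_bound (S i)) as Ha. cbn [pow] in Ha.
      pose proof (IH (n - i)%nat ltac:(lia)) as Hb.
      pose proof (Rabs_pos (Q2R (qa (S i)))).
      pose proof (Rabs_pos (Q2R (qinv (n - i)))). nra.
    + rewrite <- scal_sum, tech3 by lra.
      pose proof (pow_lt (1 / 2) (S n) ltac:(lra)). lra.
Qed.

Lemma CV_radius_ge_1 (u : nat -> R) :
  (forall n, Rabs (u n) <= 1) -> Rbar_le 1 (CV_radius u).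
Proof.
  intros H. destruct (CV_radius_bounded u) as [Hub _]. apply Hub.
  exists 1; intros n. rewrite pow1, Rmult_1_r. apply H.
Qed.

Lemma is_pseries_qa t : t <> 0 ->
  is_pseries (fun j => Q2R (qa j)) t ((1 - exp (- t)) / t).
Proof.
  intros Ht. apply is_pseries_R.
  replace ((1 - exp (- t)) / t) with (scal (- / t) (exp (- t) - 1))
    by (unfold scal; simpl; unfold mult; simpl; field; exact Ht).
  apply (is_series_ext
    (fun j => scal (- / t) (/ INR (fact (S j)) * (- t) ^ S j))).
  - intros j. rewrite Q2R_qa.
    replace (- t) with (-1 * t) by ring. rewrite Rpow_mult_distr.
    cbn [pow]. unfold scal; simpl. unfold mult; simpl.
    change (fact j + j * fact j)%nat with (fact (S j)).
    field. split; [apply INR_fact_neq_0|exact Ht].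
  - refine (is_series_scal (V := R_NormedModule) (- / t) _ (exp (- t) - 1) _).
    apply (is_series_incr_1 (fun j => / INR (fact j) * (- t) ^ j)).
    replace (plus _ _) with (exp (- t)).
    + apply is_pseries_R, is_exp_Reals.
    + unfold plus; simpl. field.
Qed.

Lemma laurent_coefficients_exist : exists b : Z -> Q, laurent_coefficients b.
Proof.
  exists (fun k => qinv (Z.to_nat (k + 1))), 1; split; [lra|].
  intros t [Ht0 Ht1].
  assert (Ht : t <> 0) by (intros ->; rewrite Rabs_R0 in Ht0; lra).
  assert (Hra : Rbar_lt (Rabs t) (CV_radius (fun j => Q2R (qa j)))).
  { apply (Rbar_lt_le_trans _ 1); [exact Ht1|]. apply CV_radius_ge_1; intros n.
    eapply Rle_trans; [apply qa_bound|].
    apply Rle_trans with (1 ^ n); [apply pow_incr; lra|rewrite pow1; lra]. }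
  assert (Hrc : Rbar_lt (Rabs t) (CV_radius (fun j => Q2R (qinv j)))).
  { apply (Rbar_lt_le_trans _ 1); [exact Ht1|]. apply CV_radius_ge_1, qinv_bound. }
  pose proof (PSeries_correct _ _ (CV_radius_inside _ _ Hrc)) as Hc.
  pose proof (is_pseries_mult _ _ _ _ _ (is_pseries_qa t Ht) Hc Hra Hrc) as Hm.
  set (L := PSeries (fun j => Q2R (qinv j)) t) in *.
  assert (H1 : is_pseries (PS_mult (fun j => Q2R (qa j)) (fun j => Q2R (qinv j))) t 1).
  { apply is_pseries_ext with (a := fun j => match j with O => 1 | _ => 0 end).
    - intros [|n]; unfold PS_mult.
      + simpl. unfold qa, qinv, Q2R; simpl. field.
      + rewrite decomp_sum by lia. cbn [pred Nat.sub].
        rewrite Q2R_qinv_S, Q2R_qa. simpl fact. simpl. field_simplify. ring.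
    - replace 1 with (1 + 0) at 2 by ring.
      apply is_pseries_R, is_series_decr_1.
      apply (is_series_ext (fun _ => 0)).
      + intros n. symmetry; apply Rmult_0_l.
      + match goal with |- is_series _ ?x => replace x with 0 end.
        * apply (filterlim_ext (fun _ => 0)); [|apply filterlim_const].
          intros n. rewrite sum_n_const. ring.
        * unfold plus, opp; simpl. ring. }
  assert (HL : (1 - exp (- t)) / t * L = 1).
  { transitivity (PSeries (PS_mult (fun j => Q2R (qa j)) (fun j => Q2R (qinv j))) t).
    - symmetry; apply is_pseries_unique; exact Hm.
    - apply is_pseries_unique; exact H1. }
  assert (He : 1 - exp (- t) <> 0).
  { intros E; rewrite E in HL. unfold Rdiv in HL. lra. }
  replace (/ (1 - exp (- t))) with (/ t * L).
  2:{ apply (Rmult_eq_reg_l ((1 - exp (- t)) / t)).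
      - replace ((1 - exp (- t)) / t * (/ t * L))
          with (/ t * ((1 - exp (- t)) / t * L)) by ring.
        rewrite HL. field. auto.
      - intros E; rewrite E in HL; lra. }
  apply is_pseries_R, (is_series_scal (/ t)) in Hc.
  eapply is_series_ext; [|exact Hc].
  intros j. cbn beta.
  replace (Z.to_nat (Z.of_nat j - 1 + 1)) with j by lia.
  unfold scal; simpl. unfold mult; simpl.
  unfold Z.sub. rewrite powerRZ_add by auto. rewrite <- pow_powerRZ. simpl. field. auto.
Qed.

(* Main.v *)
Require Import Defs.
From Stdlib Require Import Reals Factorial ZArith QArith Qpower Qreals Lra Lia.
From Coquelicot Require Import Coquelicot.

Open Scope R_scope.

(* Let [p_d] be the polynomial [(-1)^d B_d(x) / d!], whose coefficients are the [b_k].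
   Repeated integration by parts shows that the integrand of the theorem is
   [e^(-t) / (1 - e^(-t))] times the Laplace transform of [p_(2n+1)] over [0, 1].
   Expanding the geometric series and integrating over [t], the integral becomes
   [sum_(k >= 1) int_0^1 p_(2n+1)(x) / (x + k) dx], and [c_n] is the missing term
   [k = 0]; so [I + c_n] is the improper integral over [0, oo) of
   [p_(2n+1)({x}) / x]. Inserting the Fourier series
   [p_(2n+1)(x) = (-1)^n sum_m 2 sin(2 pi m x) / (2 pi m)^(2n+1)] and Dirichlet's
   [int_0^oo sin u / u du = pi / 2] gives [zeta(2n+1)]. *)

(** * Calculus lemmas and the sine integral *)

(** The obstacle is the exchange of the Fourier sum with an integral over [0, oo) that converges
    only conditionally. Two finite cut-offs settle it: [N + 1] harmonics and [K + 1] unit intervals.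
    For fixed [K] the Fourier error is a multiple of [K + 1] that vanishes as [N] grows, so [N] goes
    to infinity first; what is left is [O(1 / (K + 1))], the tail of the sine integral. Truncating
    the geometric series costs an error of the same order, uniform in both ends of the integration
    range.

    Estimates mostly compare increments of two functions through their derivatives. The Fourier
    series is obtained this way: polynomials and partial sums obey the same rule, that the
    derivative is minus the function of the previous degree. Their difference thus descends to the
    Dirichlet kernel, and bounds climb back up because every difference has a zero inside (0, 1).
    The vanishing of the Bernoulli numbers of odd index and the reflection about 1/2 are then read
    off the Fourier series.

    For the period claim, [c_n] is itself the integral of [c_n * exp (- t)] and joins the
    integrand. *)

Lemma mean_value_open (f df : R -> R) (a b : R) :
  a < b ->
  (forall x, a <= x <= b -> continuous f x) ->
  (forall x, a < x < b -> is_derive f x (df x)) ->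
  exists c, a < c < b /\ f b - f a = df c * (b - a).
Proof.
  intros Hab Cf Df.
  destruct (MVT f id a b
    (fun c P => exist _ (df c) (proj1 (is_derive_Reals f c (df c)) (Df c P)))
    (fun c _ => derivable_pt_id c) Hab) as (c & P & Hc).
  - intros c Hc. apply continuity_pt_filterlim, Cf, Hc.
  - intros c Hc. apply derivable_continuous, derivable_id.
  - exists c; split; [exact P|].
    rewrite derive_pt_id in Hc. cbn in Hc. unfold id in Hc. lra.
Qed.

(** The mean value theorem applied to [g - f] and [g + f]. Derivatives are required only inside the
    interval, because [g] will be a square root whose slope is infinite at an endpoint. *)
Lemma increment_le_of_derive_le (f g df dg : R -> R) (a b : R) :
  a <= b ->
  (forall x, a <= x <= b -> continuous f x) ->
  (forall x, a <= x <= b -> continuous g x) ->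
  (forall x, a < x < b -> is_derive f x (df x)) ->
  (forall x, a < x < b -> is_derive g x (dg x)) ->
  (forall x, a < x < b -> Rabs (df x) <= dg x) ->
  Rabs (f b - f a) <= g b - g a.
Proof.
  intros Hab Cf Cg Df Dg Hle.
  destruct Hab as [Hab| ->]; [|rewrite !Rminus_diag, Rabs_R0; lra].
  assert (key : forall s, s = 1 \/ s = -1 -> s * (f b - f a) <= g b - g a).
  { intros s Hs.
    destruct (mean_value_open (fun x => g x - s * f x) (fun x => dg x - s * df x)
                a b Hab) as (c & Hc & E).
    - intros x Hx. apply (continuous_minus g (fun x => s * f x)); [auto|].
      apply (continuous_scal_r s f); auto.
    - intros x Hx. apply (is_derive_minus g (fun x => s * f x)); [auto|].
      apply is_derive_scal; auto.
    - cbn beta in E. specialize (Hle c Hc). apply Rabs_le_between in Hle.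
      destruct Hs as [-> | ->]; nra. }
  apply Rabs_le. pose proof (key 1 (or_introl eq_refl)).
  pose proof (key (-1) (or_intror eq_refl)). lra.
Qed.

Lemma is_derive_RInt_continuous_param (f df : R -> R -> R) (a b t : R) :
  (forall x, Rmin a b <= x <= Rmax a b ->
     locally x (fun y => forall s, is_derive (fun u => f u y) s (df s y))) ->
  (forall s x, Rmin a b <= x <= Rmax a b -> continuous (f s) x) ->
  (forall x, continuity_2d_pt df t x) ->
  is_derive (fun s => RInt (f s) a b) t (RInt (df t) a b).
Proof.
  intros Hd Hc H2.
  replace (RInt (df t) a b) with (RInt (fun x => Derive (fun u => f u x) t) a b).
  2:{ apply RInt_ext. intros x Hx. apply is_derive_unique.
      apply (locally_singleton x _ (Hd x ltac:(lra))). }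
  apply (is_derive_RInt_param f).
  - apply filter_forall. intros s x Hx. exists (df s x).
    apply (locally_singleton x _ (Hd x Hx)).
  - intros x Hx. apply (continuity_2d_pt_ext_loc df); [|apply H2].
    destruct (Hd x Hx) as [d Hd']. exists d. intros u v _ Hv.
    symmetry. apply is_derive_unique, Hd', Hv.
  - apply filter_forall. intros s. apply (ex_RInt_continuous (f s)). auto.
Qed.

Lemma exp_le_compat (x y : R) : x <= y -> exp x <= exp y.
Proof. intros [H| ->]; [left; apply exp_increasing, H|apply Rle_refl]. Qed.

(** From [y - y ^ 3 / 6 <= sin y]: as [y <= 2], the cubic term is at most [2 * y / 3]. *)
Lemma sin_ge_third (y : R) : 0 <= y <= PI / 2 -> y / 3 <= sin y.
Proof.
  intros [H0 H1]. pose proof PI_4 as H4.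
  destruct (pre_sin_bound y 0 H0 ltac:(lra)) as [Hs _].
  unfold sin_approx, sin_term in Hs. simpl in Hs. nra.
Qed.

(* Integrating [exp(iz)/z] over a quarter circle of radius [X] gives
   [int_0^X sin u / u du] in this form, where the decay is visible. *)
Definition Si (X : R) : R :=
  PI / 2 - RInt (fun v => exp (- (X * cos v)) * cos (X * sin v)) 0 (PI / 2).

Definition dSi (X : R) : R :=
  RInt (fun v => exp (- (X * cos v)) *
    (cos v * cos (X * sin v) + sin v * sin (X * sin v))) 0 (PI / 2).

Lemma is_derive_Si (X : R) : is_derive Si X (dSi X).
Proof.
  pose (f := fun X v => exp (- (X * cos v)) * cos (X * sin v)).
  pose (df := fun X v => - (exp (- (X * cos v)) *
    (cos v * cos (X * sin v) + sin v * sin (X * sin v)))).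
  replace (dSi X) with (0 - RInt (df X) 0 (PI / 2)).
  - apply (is_derive_minus (fun _ : R => PI / 2) (fun s => RInt (f s) 0 (PI / 2)));
      [exact (is_derive_const (K := R_AbsRing) (V := R_NormedModule) (PI / 2) X)|].
    apply (is_derive_RInt_continuous_param f df).
    + intros x _. apply filter_forall. intros y s. unfold f, df.
      auto_derive; [trivial|ring].
    + intros s x _. apply (ex_derive_continuous (V := R_NormedModule)).
      unfold f. auto_derive. trivial.
    + assert (Hi : forall g : R -> R, (forall v, ex_derive g v) -> forall x,
                continuity_2d_pt (fun _ v => g v) X x).
      { intros g Hg x. apply (continuity_1d_2d_pt_comp g (fun _ v => v)).
        - apply continuity_pt_filterlim, (ex_derive_continuous g), Hg.
        - apply continuity_2d_pt_id2. }
      assert (Hc : forall x, continuity_2d_pt (fun _ v => cos v) X x)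
        by (apply Hi; intros; auto_derive; trivial).
      assert (Hs : forall x, continuity_2d_pt (fun _ v => sin v) X x)
        by (apply Hi; intros; auto_derive; trivial).
      assert (He : continuity exp) by (apply derivable_continuous, derivable_exp).
      pose proof continuity_cos as Kc. pose proof continuity_sin as Ks.
      intros x. unfold df.
      repeat first
        [ apply Hc | apply Hs | apply continuity_2d_pt_id1
        | apply continuity_2d_pt_opp | apply continuity_2d_pt_plus
        | apply continuity_2d_pt_mult
        | apply (continuity_1d_2d_pt_comp exp); [apply He|]
        | apply (continuity_1d_2d_pt_comp cos); [apply Kc|]
        | apply (continuity_1d_2d_pt_comp sin); [apply Ks|] ].
  - unfold dSi. set (g := fun v => exp (- (X * cos v)) * _).
    replace (RInt (df X) 0 (PI / 2)) with (- RInt g 0 (PI / 2)); [ring|].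
    symmetry. apply (RInt_opp g). apply ex_RInt_continuous. intros z _.
    apply (ex_derive_continuous (V := R_NormedModule)). unfold g. auto_derive. trivial.
Qed.

(** [X] times the integrand is the derivative in [v] of [exp (- (X * cos v)) * sin (X * sin v)], the
    imaginary part of [exp(iz)] on the quarter circle. Stated without division, this covers
    [X = 0]. *)
Lemma mul_dSi (X : R) : X * dSi X = sin X.
Proof.
  unfold dSi. set (g := fun v => exp (- (X * cos v)) * _).
  transitivity (RInt (fun v => X * g v) 0 (PI / 2)).
  { symmetry. apply (RInt_scal g). apply ex_RInt_continuous. intros z _.
    apply (ex_derive_continuous (V := R_NormedModule)). unfold g. auto_derive. trivial. }
  pose (G := fun v => exp (- (X * cos v)) * sin (X * sin v)).
  apply is_RInt_unique. replace (sin X) with (G (PI / 2) - G 0).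
  - apply (is_RInt_derive (V := R_CompleteNormedModule) G).
    + intros v _. unfold G, g. auto_derive; [trivial|ring].
    + intros v _. apply (ex_derive_continuous (V := R_NormedModule)).
      unfold g. auto_derive. trivial.
  - unfold G. rewrite cos_PI2, sin_PI2, sin_0.
    rewrite !Rmult_0_r, Rmult_1_r, Ropp_0, exp_0, sin_0. ring.
Qed.

(** Dirichlet's integral with a rate: on the arc [cos v = sin (PI / 2 - v)] is at least
    [(PI / 2 - v) / 3], so an exponential of total integral below [3 / X] dominates. *)
Lemma Si_bound (X : R) : 0 < X -> Rabs (Si X - PI / 2) <= 3 / X.
Proof.
  intros HX. pose proof PI_RGT_0 as Hpi. unfold Si.
  match goal with |- context [RInt ?f _ _] => set (g := f) end.
  replace (PI / 2 - RInt g 0 (PI / 2) - PI / 2) with (- RInt g 0 (PI / 2)) by ring.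
  rewrite Rabs_Ropp.
  pose (G := fun v => 3 / X * exp (- (X * ((PI / 2 - v) / 3)))).
  apply Rle_trans with (G (PI / 2) - G 0).
  - apply (norm_RInt_le (V := R_NormedModule) g
             (fun v => exp (- (X * ((PI / 2 - v) / 3)))) 0 (PI / 2)).
    + lra.
    + intros v Hv. unfold g. change (norm ?x) with (Rabs x).
      rewrite Rabs_mult, (Rabs_pos_eq (exp _)) by (left; apply exp_pos).
      assert (Hcos : Rabs (cos (X * sin v)) <= 1) by (apply Rabs_le, COS_bound).
      assert (exp (- (X * cos v)) <= exp (- (X * ((PI / 2 - v) / 3)))).
      { apply exp_le_compat, Ropp_le_contravar, Rmult_le_compat_l; [lra|].
        rewrite <- sin_shift. apply sin_ge_third. lra. }
      pose proof (exp_pos (- (X * cos v))). pose proof (Rabs_pos (cos (X * sin v))).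
      nra.
    + apply (RInt_correct (V := R_CompleteNormedModule)), ex_RInt_continuous.
      intros v _. apply (ex_derive_continuous (V := R_NormedModule)).
      unfold g. auto_derive. trivial.
    + apply (is_RInt_derive (V := R_CompleteNormedModule) G).
      * intros v _. unfold G. auto_derive; [trivial|].
        change ((PI / 2 + - v) * / 3) with ((PI / 2 - v) / 3). field. lra.
      * intros v _. apply (ex_derive_continuous (V := R_NormedModule)). auto_derive. trivial.
  - unfold G. rewrite Rminus_diag, Rdiv_0_l, Rmult_0_r, Ropp_0, exp_0.
    pose proof (exp_pos (- (X * ((PI / 2 - 0) / 3)))).
    assert (0 < 3 / X) by (apply Rdiv_lt_0_compat; lra). nra.
Qed.

(** * Bernoulli polynomials and their Fourier series *)

Lemma is_derive_sum_f_R0 (f df : nat -> R -> R) (n : nat) (x : R) :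
  (forall l, (l <= n)%nat -> is_derive (f l) x (df l x)) ->
  is_derive (fun y => sum_f_R0 (fun l => f l y) n) x (sum_f_R0 (fun l => df l x) n).
Proof.
  induction n as [|n IH]; intros H; simpl; [apply H; lia|].
  apply (is_derive_plus (fun y => sum_f_R0 (fun l => f l y) n) (f (S n))).
  - apply IH. intros l Hl. apply H. lia.
  - apply H. lia.
Qed.

(* For [beta j = b_(j-1)] this is the coefficient of [t^(d-1)] in
   [e^(-xt) / (1 - e^(-t))], that is, [(-1)^d B_d(x) / d!]. *)
Definition appell (beta : nat -> R) (d : nat) (x : R) : R :=
  sum_f_R0 (fun l => beta (d - l)%nat * ((- x) ^ l / INR (fact l))) d.

Lemma appell_0 (beta : nat -> R) (d : nat) : appell beta d 0 = beta d.
Proof.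
  unfold appell. rewrite Ropp_0. destruct d as [|d]; [simpl; field|].
  rewrite decomp_sum by lia. rewrite sum_eq_R0.
  - simpl. field.
  - intros l _. cbn [pow]. unfold Rdiv. ring.
Qed.

Lemma is_derive_appell (beta : nat -> R) (d : nat) (x : R) :
  is_derive (appell beta (S d)) x (- appell beta d x).
Proof.
  apply (is_derive_ext (fun y => beta (S d) + sum_f_R0
    (fun l => beta (d - l)%nat * ((- y) ^ S l / INR (fact (S l)))) d)).
  - intros y. unfold appell. rewrite (decomp_sum _ (S d)) by lia.
    cbn [pred]. f_equal. simpl. field.
  - replace (- appell beta d x) with (0 + sum_f_R0
      (fun l => beta (d - l)%nat * ((- x) ^ l / INR (fact l)) * -1) d).
    + apply (is_derive_plus (fun _ : R => beta (S d)));
        [exact (is_derive_const (K := R_AbsRing) (V := R_NormedModule) _ x)|].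
      apply (is_derive_sum_f_R0
        (fun l y => beta (d - l)%nat * ((- y) ^ S l / INR (fact (S l))))
        (fun l y => beta (d - l)%nat * ((- y) ^ l / INR (fact l)) * -1)).
      intros l _. replace (INR (fact (S l))) with (INR (S l) * INR (fact l))
        by (rewrite <- mult_INR; reflexivity).
      pose proof (INR_fact_neq_0 l). pose proof (not_0_INR (S l) ltac:(lia)).
      auto_derive; [trivial|]. simpl. field. auto.
    + unfold appell. rewrite <- scal_sum. ring.
Qed.

(* Equivalently [(sum_j beta_j t^j) (1 - e^(-t)) = t] as formal power series. *)
Definition bernoulli_like (beta : nat -> R) : Prop :=
  forall d, appell beta d 1 = beta d - (if Nat.eqb d 1 then 1 else 0).

Lemma bernoulli_like_0 (beta : nat -> R) : bernoulli_like beta -> beta 0%nat = 1.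
Proof. intros H. specialize (H 1%nat). unfold appell in H. simpl in H. lra. Qed.

Lemma bernoulli_like_1 (beta : nat -> R) : bernoulli_like beta -> beta 1%nat = 1 / 2.
Proof.
  intros H. pose proof (bernoulli_like_0 beta H).
  specialize (H 2%nat). unfold appell in H. simpl in H. lra.
Qed.

(** Partial sum, with [N + 1] harmonics, of the Fourier series of [appell beta (S k)], of degree
    [k + 1]. The phase [k * PI / 2] treats sine and cosine series at once and gives differentiation
    the same factor [-1] as for [appell]. *)
Definition bernoulli_fourier (k N : nat) (x : R) : R :=
  sum_f_R0 (fun m => 2 * sin (2 * PI * INR (S m) * x + INR k * (PI / 2))
                     / (2 * PI * INR (S m)) ^ S k) N.

Definition fourier_error (beta : nat -> R) (k N : nat) (x : R) : R :=
  appell beta (S k) x - bernoulli_fourier k N x.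

Lemma INR_S_pos (m : nat) : 0 < INR (S m).
Proof. apply lt_0_INR. lia. Qed.

Lemma two_PI_INR_S_pos (m : nat) : 0 < 2 * PI * INR (S m).
Proof. pose proof PI_RGT_0. pose proof (INR_S_pos m). nra. Qed.

Lemma is_derive_bernoulli_fourier (k N : nat) (x : R) :
  is_derive (bernoulli_fourier (S k) N) x (- bernoulli_fourier k N x).
Proof.
  replace (- bernoulli_fourier k N x) with (sum_f_R0
    (fun m => 2 * sin (2 * PI * INR (S m) * x + INR k * (PI / 2))
                     / (2 * PI * INR (S m)) ^ S k * -1) N).
  - apply (is_derive_sum_f_R0
      (fun m y => 2 * sin (2 * PI * INR (S m) * y + INR (S k) * (PI / 2))
                     / (2 * PI * INR (S m)) ^ S (S k))
      (fun m y => 2 * sin (2 * PI * INR (S m) * y + INR k * (PI / 2))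
                     / (2 * PI * INR (S m)) ^ S k * -1)).
    intros m _. pose proof (two_PI_INR_S_pos m).
    set (a := 2 * PI * INR (S m)) in *. rewrite S_INR.
    replace (sin (a * x + INR k * (PI / 2)))
      with (- cos (a * x + (INR k + 1) * (PI / 2))).
    + auto_derive; [trivial|]. cbn [pow].
      pose proof (pow_nonzero a k ltac:(lra)). field. lra.
    + replace (a * x + (INR k + 1) * (PI / 2))
        with (PI / 2 + (a * x + INR k * (PI / 2))) by field.
      rewrite <- sin_cos. reflexivity.
  - unfold bernoulli_fourier. rewrite <- scal_sum. ring.
Qed.

Lemma bernoulli_fourier_periodic (k N : nat) :
  bernoulli_fourier k N 1 = bernoulli_fourier k N 0.
Proof.
  apply sum_eq. intros m _. f_equal. f_equal.
  rewrite Rmult_0_r, Rplus_0_l, <- (sin_period (INR k * (PI / 2)) (S m)).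
  f_equal. ring.
Qed.

Lemma is_derive_fourier_error (beta : nat -> R) (k N : nat) (x : R) :
  is_derive (fourier_error beta (S k) N) x (- fourier_error beta k N x).
Proof.
  unfold fourier_error.
  replace (- _) with (minus (- appell beta (S k) x) (- bernoulli_fourier k N x))
    by (unfold minus, plus, opp; simpl; ring).
  apply (is_derive_minus (appell beta (S (S k))) (bernoulli_fourier (S k) N)).
  - apply is_derive_appell.
  - apply is_derive_bernoulli_fourier.
Qed.

(** Rolle's theorem for the next error, whose polynomial has degree at least 2 and so takes equal
    values at 0 and 1. The zero is the base point from which errors are integrated. *)
Lemma fourier_error_zero (beta : nat -> R) (k N : nat) :
  bernoulli_like beta -> exists c, 0 < c < 1 /\ fourier_error beta k N c = 0.
Proof.
  intros Hb.
  destruct (mean_value_open (fourier_error beta (S k) N)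
    (fun x => - fourier_error beta k N x) 0 1) as (c & Hc & E); [lra| | |].
  - intros x _. apply (ex_derive_continuous (V := R_NormedModule)).
    eexists. apply is_derive_fourier_error.
  - intros x _. apply is_derive_fourier_error.
  - exists c. split; [exact Hc|]. revert E. unfold fourier_error at 1 2.
    rewrite bernoulli_fourier_periodic, Hb, appell_0. simpl Nat.eqb. lra.
Qed.

(** Integrating from a zero inside an interval of length 1 does not enlarge the bound, so one rate
    serves all degrees. *)
Lemma fourier_error_bound_succ (beta : nat -> R) (k N : nat) (e : R) :
  bernoulli_like beta ->
  (forall x, 0 <= x <= 1 -> Rabs (fourier_error beta k N x) <= e) ->
  forall x, 0 <= x <= 1 -> Rabs (fourier_error beta (S k) N x) <= e.
Proof.
  intros Hb He.
  assert (incr : forall y z, 0 <= y <= z -> z <= 1 ->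
    Rabs (fourier_error beta (S k) N z - fourier_error beta (S k) N y) <= e).
  { intros y z Hyz Hz.
    assert (0 <= e) by (eapply Rle_trans; [apply Rabs_pos|apply (He 0); lra]).
    apply Rle_trans with (e * z - e * y); [|nra].
    apply (increment_le_of_derive_le (fourier_error beta (S k) N) (fun v => e * v)
             (fun v => - fourier_error beta k N v) (fun _ => e)); [lra| | | | |].
    - intros v _. apply (ex_derive_continuous (V := R_NormedModule)).
      eexists. apply is_derive_fourier_error.
    - intros v _. apply (ex_derive_continuous (V := R_NormedModule)). auto_derive. trivial.
    - intros v _. apply is_derive_fourier_error.
    - intros v _. auto_derive; [trivial|ring].
    - intros v Hv. rewrite Rabs_Ropp. apply He. lra. }
  destruct (fourier_error_zero beta (S k) N Hb) as (c & Hc & E).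
  intros x Hx. destruct (Rle_dec c x) as [H|H].
  - specialize (incr c x). rewrite E, Rminus_0_r in incr. apply incr; lra.
  - specialize (incr x c). rewrite E, Rminus_0_l, Rabs_Ropp in incr. apply incr; lra.
Qed.

(** * The Dirichlet kernel and uniform bounds for the Fourier error *)

Lemma dirichlet_kernel (N : nat) (y : R) :
  sin y * (1 + sum_f_R0 (fun m => 2 * cos (2 * INR (S m) * y)) N)
  = sin ((2 * INR N + 3) * y).
Proof.
  induction N as [|N IH].
  - simpl. replace (2 * 1 * y) with (2 * y) by ring.
    replace ((2 * 0 + 3) * y) with (2 * y + y) by ring.
    rewrite sin_plus, cos_2a, sin_2a. pose proof (sin2_cos2 y) as E.
    unfold Rsqr in E.
    replace (cos y * cos y) with (1 - sin y * sin y) by lra. ring_simplify.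
    replace (cos y ^ 2) with (1 - sin y ^ 2) by (simpl; lra). ring.
  - cbn [sum_f_R0]. rewrite <- Rplus_assoc, Rmult_plus_distr_l, IH, !S_INR.
    replace ((2 * INR N + 3) * y) with (2 * (INR N + 1 + 1) * y - y) by ring.
    replace ((2 * (INR N + 1) + 3) * y) with (2 * (INR N + 1 + 1) * y + y) by ring.
    rewrite sin_plus, sin_minus. ring.
Qed.

Definition dirichlet (N : nat) (x : R) : R :=
  1 + sum_f_R0 (fun m => 2 * cos (2 * PI * INR (S m) * x)) N.

Lemma is_derive_fourier_error_0 (beta : nat -> R) (N : nat) (x : R) :
  bernoulli_like beta ->
  is_derive (fourier_error beta 0 N) x (- dirichlet N x).
Proof.
  intros Hb. unfold fourier_error, dirichlet.
  replace (- _) with (minus (- appell beta 0 x)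
    (sum_f_R0 (fun m => 2 * cos (2 * PI * INR (S m) * x)) N)).
  - apply (is_derive_minus (appell beta 1) (bernoulli_fourier 0 N)).
    + apply is_derive_appell.
    + apply (is_derive_sum_f_R0
        (fun m y => 2 * sin (2 * PI * INR (S m) * y + INR 0 * (PI / 2))
                     / (2 * PI * INR (S m)) ^ 1)
        (fun m y => 2 * cos (2 * PI * INR (S m) * y))).
      intros m _. pose proof (two_PI_INR_S_pos m).
      set (a := 2 * PI * INR (S m)) in *. clearbody a.
      auto_derive; [trivial|]. simpl INR. rewrite Rmult_0_l, Rplus_0_r. field. lra.
  - unfold appell. simpl. rewrite (bernoulli_like_0 beta Hb).
    unfold minus, plus, opp; simpl. field.
Qed.

(** Lets the estimates be proved on [0, 1/2] only. *)
Lemma fourier_error_0_reflect (beta : nat -> R) (N : nat) (x : R) :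
  bernoulli_like beta ->
  fourier_error beta 0 N (1 - x) = - fourier_error beta 0 N x.
Proof.
  intros Hb. unfold fourier_error.
  assert (Ha : forall y, appell beta 1 y = 1 / 2 - y).
  { intros y. unfold appell. simpl.
    rewrite (bernoulli_like_0 beta Hb), (bernoulli_like_1 beta Hb). field. }
  assert (Hf : bernoulli_fourier 0 N (1 - x) = -1 * bernoulli_fourier 0 N x).
  { unfold bernoulli_fourier. rewrite scal_sum. apply sum_eq. intros m _.
    simpl (INR 0). rewrite Rmult_0_l, !Rplus_0_r.
    replace (2 * PI * INR (S m) * (1 - x))
      with (- (2 * PI * INR (S m) * x) + 2 * INR (S m) * PI) by ring.
    rewrite sin_period, sin_neg. unfold Rdiv. ring. }
  rewrite !Ha, Hf. field.
Qed.

Lemma sin_PI_mul_ge (x : R) : 0 <= x <= 1 / 2 -> x <= sin (PI * x).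
Proof.
  intros Hx. pose proof PI2_3_2.
  pose proof (sin_ge_third (PI * x) ltac:(split; nra)). nra.
Qed.

Lemma bernoulli_fourier_0_half (N : nat) : bernoulli_fourier 0 N (1 / 2) = 0.
Proof.
  apply sum_eq_R0. intros m _. simpl (INR 0).
  replace (2 * PI * INR (S m) * (1 / 2) + 0 * (PI / 2))
    with (0 + INR (S m) * PI) by field.
  rewrite Rplus_0_l, (sin_eq_0_1 (INR (S m) * PI)); [unfold Rdiv; ring|].
  exists (Z.of_nat (S m)). rewrite INR_IZR_INZ. reflexivity.
Qed.

(** With [w] this number, the kernel with [N + 1] cosines is [sin (w * x) / sin (PI * x)]. *)
Definition dirichlet_freq (N : nat) : R := (2 * INR N + 3) * PI.

Lemma dirichlet_freq_pos (N : nat) : 0 < dirichlet_freq N.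
Proof. unfold dirichlet_freq. pose proof PI_RGT_0. pose proof (pos_INR N). nra. Qed.

(* One integration by parts of the Dirichlet kernel, from the zero at [1/2]. *)
Lemma fourier_error_0_interior (beta : nat -> R) (N : nat) (x : R) :
  bernoulli_like beta -> 0 < x <= 1 / 2 ->
  Rabs (fourier_error beta 0 N x) <= 2 / (dirichlet_freq N * x).
Proof.
  intros Hb Hx. set (w := dirichlet_freq N).
  assert (Hw : 0 < w) by apply dirichlet_freq_pos.
  pose proof PI_RGT_0 as Hpi.
  assert (Hs : forall y, x <= y <= 1 / 2 -> 0 < sin (PI * y)).
  { intros y Hy. pose proof (sin_PI_mul_ge y). lra. }
  (* Integrating [- sin (w * y) / sin (PI * y)] by parts produces the boundary term subtracted in
     [g]. The derivative [dg] that remains carries a factor [1 / w]; [dh] is [dg] with [cos (w * y)]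
     replaced by its bound 1. *)
  pose (g := fun y => fourier_error beta 0 N y - cos (w * y) / (w * sin (PI * y))).
  pose (dg := fun y => PI * cos (w * y) * cos (PI * y) / (w * (sin (PI * y))²)).
  pose (h := fun y => - (1 / (w * sin (PI * y)))).
  pose (dh := fun y => PI * cos (PI * y) / (w * (sin (PI * y))²)).
  assert (Dg : forall y, x <= y <= 1 / 2 -> is_derive g y (dg y)).
  { intros y Hy. pose proof (Hs y Hy) as Hsy. unfold g, dg.
    replace (_ / _) with (minus (- dirichlet N y)
      (- sin (w * y) / sin (PI * y)
        - PI * cos (w * y) * cos (PI * y) / (w * (sin (PI * y))²))).
    - apply (is_derive_minus (fourier_error beta 0 N)
               (fun y => cos (w * y) / (w * sin (PI * y)))).
      + apply is_derive_fourier_error_0, Hb.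
      + auto_derive; [nra|]. unfold Rsqr. field. lra.
    - replace (dirichlet N y) with (sin (w * y) / sin (PI * y)).
      + unfold minus, plus, opp, Rsqr; simpl. field. lra.
      + unfold w, dirichlet_freq. rewrite Rmult_assoc, <- dirichlet_kernel.
        replace (dirichlet N y)
          with (1 + sum_f_R0 (fun m => 2 * cos (2 * INR (S m) * (PI * y))) N).
        * field. lra.
        * unfold dirichlet. f_equal. apply sum_eq. intros m _. do 2 f_equal. ring. }
  assert (Dh : forall y, x <= y <= 1 / 2 -> is_derive h y (dh y)).
  { intros y Hy. pose proof (Hs y Hy) as Hsy. unfold h, dh.
    auto_derive; [nra|]. unfold Rsqr. field. lra. }
  assert (incr : Rabs (g (1 / 2) - g x) <= h (1 / 2) - h x).
  { apply (increment_le_of_derive_le g h dg dh); [lra| | | | |].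
    - intros y Hy. apply (ex_derive_continuous (V := R_NormedModule)).
      eexists. apply Dg, Hy.
    - intros y Hy. apply (ex_derive_continuous (V := R_NormedModule)).
      eexists. apply Dh, Hy.
    - intros y Hy. apply Dg. lra.
    - intros y Hy. apply Dh. lra.
    - intros y Hy. specialize (Hs y ltac:(lra)). unfold dg, dh.
      assert (Hc : 0 <= cos (PI * y)) by (apply cos_ge_0; nra).
      assert (Hsq : 0 < w * (sin (PI * y))²) by (unfold Rsqr; apply Rmult_lt_0_compat; nra).
      unfold Rdiv. rewrite Rabs_mult, (Rabs_pos_eq (/ _))
        by (left; apply Rinv_0_lt_compat, Hsq).
      apply Rmult_le_compat_r; [left; apply Rinv_0_lt_compat, Hsq|].
      rewrite !Rabs_mult, (Rabs_pos_eq PI), (Rabs_pos_eq (cos (PI * y))) by lra.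
      assert (Rabs (cos (w * y)) <= 1) by (apply Rabs_le, COS_bound).
      assert (0 <= PI * cos (PI * y)) by nra. nra. }
  (* At [1 / 2] the Fourier error vanishes, and so does the cosine, [w / 2] being an odd multiple of
     [PI / 2]. *)
  assert (g12 : g (1 / 2) = 0).
  { unfold g, fourier_error. rewrite bernoulli_fourier_0_half.
    replace (cos (w * (1 / 2))) with 0.
    - unfold appell. simpl.
      rewrite (bernoulli_like_0 beta Hb), (bernoulli_like_1 beta Hb). field.
      specialize (Hs (1 / 2) ltac:(lra)). unfold Rdiv in Hs. lra.
    - symmetry. apply cos_eq_0_1. exists (Z.of_nat N + 1)%Z.
      rewrite plus_IZR, <- INR_IZR_INZ. unfold w, dirichlet_freq. field. }
  assert (h12 : h (1 / 2) <= 0).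
  { unfold h. specialize (Hs (1 / 2) ltac:(lra)).
    assert (0 < 1 / (w * sin (PI * (1 / 2)))) by (apply Rdiv_lt_0_compat; nra). lra. }
  assert (Hq : 0 < 1 / (w * sin (PI * x)) <= 1 / (w * x)).
  { specialize (Hs x ltac:(lra)). split; [apply Rdiv_lt_0_compat; nra|].
    apply Rmult_le_compat_l; [lra|]. apply Rinv_le_contravar; [nra|].
    apply Rmult_le_compat_l; [lra|]. apply sin_PI_mul_ge. lra. }
  assert (Hcs : Rabs (cos (w * x) / (w * sin (PI * x))) <= 1 / (w * sin (PI * x))).
  { specialize (Hs x ltac:(lra)). unfold Rdiv.
    rewrite Rabs_mult, (Rabs_pos_eq (/ _)) by (left; apply Rinv_0_lt_compat; nra).
    apply Rmult_le_compat_r; [left; apply Rinv_0_lt_compat; nra|].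
    apply Rabs_le, COS_bound. }
  (* The boundary term and the remaining integral each contribute at most [1 / (w * x)], hence the
     2. *)
  rewrite g12, Rminus_0_l, Rabs_Ropp in incr.
  replace (fourier_error beta 0 N x) with (g x + cos (w * x) / (w * sin (PI * x)))
    by (unfold g; ring).
  eapply Rle_trans; [apply Rabs_triang|].
  replace (2 / (w * x)) with (1 / (w * x) + 1 / (w * x)) by (field; lra).
  unfold h in incr at 2. lra.
Qed.

Lemma dirichlet_bound (N : nat) (x : R) : Rabs (dirichlet N x) <= 2 * INR N + 3.
Proof.
  unfold dirichlet. induction N as [|N IH]; cbn [sum_f_R0].
  - apply Rabs_le. pose proof (COS_bound (2 * PI * INR 1 * x)). simpl INR in *. lra.
  - rewrite <- Rplus_assoc, (S_INR N). eapply Rle_trans; [apply Rabs_triang|].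
    assert (Rabs (2 * cos (2 * PI * INR (S (S N)) * x)) <= 2)
      by (apply Rabs_le; pose proof (COS_bound (2 * PI * INR (S (S N)) * x)); lra).
    lra.
Qed.

(** For [w * x >= 1] the interior estimate suffices. Closer to 0 the error starts from 1/2, half the
    jump, and its slope is at most [w], so it stays below 3/2. *)
Lemma fourier_error_0_bounded (beta : nat -> R) (N : nat) (x : R) :
  bernoulli_like beta -> 0 <= x <= 1 / 2 -> Rabs (fourier_error beta 0 N x) <= 2.
Proof.
  intros Hb Hx. set (w := dirichlet_freq N).
  assert (Hw : 0 < w) by apply dirichlet_freq_pos.
  destruct (Rle_dec 1 (w * x)) as [H|H].
  - assert (0 < x) by nra.
    eapply Rle_trans; [apply fourier_error_0_interior; [exact Hb|lra]|].
    fold w. apply Rle_div_l; nra.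
  - assert (E0 : fourier_error beta 0 N 0 = 1 / 2).
    { unfold fourier_error. rewrite appell_0, (bernoulli_like_1 beta Hb).
      unfold bernoulli_fourier. rewrite sum_eq_R0; [ring|]. intros m _.
      simpl (INR 0). rewrite Rmult_0_r, Rmult_0_l, Rplus_0_l, sin_0. unfold Rdiv. ring. }
    assert (Hinc : Rabs (fourier_error beta 0 N x - fourier_error beta 0 N 0)
                   <= w * x - w * 0).
    { apply (increment_le_of_derive_le (fourier_error beta 0 N) (fun y => w * y)
               (fun y => - dirichlet N y) (fun _ => w)); [lra| | | | |].
      - intros y _. apply (ex_derive_continuous (V := R_NormedModule)).
        eexists. apply is_derive_fourier_error_0, Hb.
      - intros y _. apply (ex_derive_continuous (V := R_NormedModule)).
        auto_derive. trivial.
      - intros y _. apply is_derive_fourier_error_0, Hb.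
      - intros y _. auto_derive; [trivial|ring].
      - intros y _. rewrite Rabs_Ropp. eapply Rle_trans; [apply dirichlet_bound|].
        unfold w, dirichlet_freq. pose proof PI2_3_2. pose proof (pos_INR N). nra. }
    rewrite E0 in Hinc. apply Rabs_le. apply Rabs_le_between in Hinc. lra.
Qed.

(** The 8 makes [fourier_rate N / 2 * sqrt x] a primitive of [2 / sqrt (w * x)], the majorant of the
    first error with [w] the frequency. Each half of [0, 1] then costs at most half the rate. *)
Definition fourier_rate (N : nat) : R := 8 / sqrt (dirichlet_freq N).

Lemma fourier_rate_lim : is_lim_seq fourier_rate 0.
Proof.
  unfold fourier_rate, Rdiv. replace (Finite 0) with (Rbar_mult 8 0).
  2:{ simpl. f_equal. ring. }
  apply is_lim_seq_scal_l. apply (is_lim_seq_inv _ p_infty); [|discriminate].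
  apply (filterlim_comp _ _ _ dirichlet_freq sqrt eventually (Rbar_locally p_infty));
    [|apply filterlim_sqrt_p].
  apply (is_lim_seq_le_p_loc INR); [|apply is_lim_seq_INR].
  exists 0%nat. intros n _. unfold dirichlet_freq. pose proof PI2_3_2.
  pose proof (pos_INR n). nra.
Qed.

(** With [u = sqrt (w * x)], the bounds [2] and [2 / u ^ 2] together give [2 / u]. Unlike [1 / x]
    this is integrable at 0, so that the next error is bounded uniformly. *)
Lemma fourier_error_0_sqrt (beta : nat -> R) (N : nat) (x : R) :
  bernoulli_like beta -> 0 < x <= 1 / 2 ->
  Rabs (fourier_error beta 0 N x) <= fourier_rate N * / (4 * sqrt x).
Proof.
  intros Hb Hx. unfold fourier_rate. set (w := dirichlet_freq N).
  assert (Hw : 0 < w) by apply dirichlet_freq_pos.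
  assert (Hsx : 0 < sqrt x) by (apply sqrt_lt_R0; lra).
  assert (Hsw : 0 < sqrt w) by (apply sqrt_lt_R0; lra).
  replace (8 / sqrt w * / (4 * sqrt x)) with (2 / (sqrt w * sqrt x)) by (field; lra).
  apply Rle_div_r; [nra|].
  destruct (Rle_dec 1 (sqrt w * sqrt x)) as [H|H].
  - apply Rle_trans with (2 / (w * x) * (sqrt w * sqrt x)).
    + apply Rmult_le_compat_r; [nra|]. apply fourier_error_0_interior; assumption.
    + replace (w * x) with ((sqrt w * sqrt w) * (sqrt x * sqrt x))
        by (rewrite !sqrt_sqrt by lra; reflexivity).
      replace (2 / _ * _) with (2 / (sqrt w * sqrt x)) by (field; lra).
      apply Rle_div_l; nra.
  - pose proof (fourier_error_0_bounded beta N x Hb ltac:(lra)).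
    pose proof (Rabs_pos (fourier_error beta 0 N x)).
    assert (0 < sqrt w * sqrt x) by nra. nra.
Qed.

Lemma fourier_error_1_bound (beta : nat -> R) (N : nat) :
  bernoulli_like beta ->
  forall x, 0 <= x <= 1 -> Rabs (fourier_error beta 1 N x) <= fourier_rate N.
Proof.
  intros Hb. set (r := fourier_rate N).
  assert (Hr : 0 < r).
  { apply Rdiv_lt_0_compat; [lra|]. apply sqrt_lt_R0, dirichlet_freq_pos. }
  assert (half : forall x, 0 <= x <= 1 ->
    Rabs (fourier_error beta 1 N x - fourier_error beta 1 N (1 / 2)) <= r / 2).
  { intros x Hx. destruct (Rle_dec x (1 / 2)) as [H|H].
    - rewrite Rabs_minus_sym.
      apply Rle_trans with (r / 2 * sqrt (1 / 2) - r / 2 * sqrt x).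
      + apply (increment_le_of_derive_le (fourier_error beta 1 N)
          (fun y => r / 2 * sqrt y) (fun y => - fourier_error beta 0 N y)
          (fun y => r * / (4 * sqrt y))); [lra| | | | |].
        * intros y _. apply (ex_derive_continuous (V := R_NormedModule)).
          eexists. apply is_derive_fourier_error.
        * intros y _. apply (continuous_scal_r (r / 2) sqrt), continuous_sqrt.
        * intros y _. apply is_derive_fourier_error.
        * intros y Hy. auto_derive; [lra|]. field.
          apply Rgt_not_eq, sqrt_lt_R0. lra.
        * intros y Hy. rewrite Rabs_Ropp. apply fourier_error_0_sqrt; [exact Hb|lra].
      + pose proof (sqrt_pos x). assert (sqrt (1 / 2) <= 1)
          by (rewrite <- sqrt_1 at 2; apply sqrt_le_1_alt; lra). nra.
    - apply Rle_trans with (- (r / 2 * sqrt (1 - x)) - - (r / 2 * sqrt (1 - 1 / 2))).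
      + apply (increment_le_of_derive_le (fourier_error beta 1 N)
          (fun y => - (r / 2 * sqrt (1 - y))) (fun y => - fourier_error beta 0 N y)
          (fun y => r * / (4 * sqrt (1 - y)))); [lra| | | | |].
        * intros y _. apply (ex_derive_continuous (V := R_NormedModule)).
          eexists. apply is_derive_fourier_error.
        * intros y _. apply (continuous_opp (fun y => r / 2 * sqrt (1 - y))).
          apply (continuous_scal_r (r / 2) (fun y => sqrt (1 - y))).
          apply (continuous_comp (fun y => 1 - y) sqrt); [|apply continuous_sqrt].
          apply (ex_derive_continuous (V := R_NormedModule)). auto_derive. trivial.
        * intros y _. apply is_derive_fourier_error.
        * intros y Hy. auto_derive; [lra|]. change (1 + - y) with (1 - y). field.
          apply Rgt_not_eq, sqrt_lt_R0. lra.
        * intros y Hy. rewrite <- fourier_error_0_reflect by exact Hb.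
          apply fourier_error_0_sqrt; [exact Hb|lra].
      + pose proof (sqrt_pos (1 - x)). assert (sqrt (1 - 1 / 2) <= 1)
          by (rewrite <- sqrt_1 at 3; apply sqrt_le_1_alt; lra). nra. }
  (* The base point moves from [1 / 2] to a zero [c], at the price of two increments of at most
     [r / 2]. *)
  destruct (fourier_error_zero beta 1 N Hb) as (c & Hc & E).
  pose proof (half c ltac:(lra)) as Hhc. rewrite E in Hhc.
  intros x Hx. specialize (half x Hx).
  apply Rabs_le. apply Rabs_le_between in half. apply Rabs_le_between in Hhc. lra.
Qed.

Lemma fourier_error_bound (beta : nat -> R) (k N : nat) :
  bernoulli_like beta ->
  forall x, 0 <= x <= 1 -> Rabs (fourier_error beta (S k) N x) <= fourier_rate N.
Proof.
  intros Hb. induction k as [|k IH].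
  - apply fourier_error_1_bound, Hb.
  - apply fourier_error_bound_succ; assumption.
Qed.

(** * Summation over the unit intervals *)

Lemma ex_series_inv_pow (s : nat) : (2 <= s)%nat -> ex_series (fun m => / INR (S m) ^ s).
Proof.
  intros Hs.
  assert (H2 : ex_series (fun m => / INR (S m) ^ 2)).
  { destruct (ex_finite_lim_seq_incr (sum_n (fun m => / INR (S m) ^ 2)) 2) as [l Hl].
    - intros N. rewrite !sum_n_Reals. cbn [sum_f_R0].
      pose proof (Rinv_0_lt_compat _ (pow_lt (INR (S (S N))) 2 (INR_S_pos (S N)))).
      lra.
    - intros N. rewrite sum_n_Reals. apply Rle_trans with (2 - / INR (S N)).
      2:{ pose proof (Rinv_0_lt_compat _ (INR_S_pos N)). lra. }
      induction N as [|N IH]; [simpl; lra|]. cbn [sum_f_R0].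
      pose proof (INR_S_pos N). rewrite (S_INR (S N)). set (a := INR (S N)) in *.
      assert (/ (a + 1) ^ 2 <= / a - / (a + 1)).
      { replace (/ a - / (a + 1)) with (/ (a * (a + 1))) by (field; lra).
        apply Rinv_le_contravar; nra. }
      lra.
    - exists l. exact Hl. }
  apply (ex_series_le (K := R_AbsRing) (V := R_CompleteNormedModule) _
           (fun m => / INR (S m) ^ 2)); [|exact H2].
  intros m. change (norm ?x) with (Rabs x).
  assert (1 <= INR (S m)) by (rewrite S_INR; pose proof (pos_INR m); lra).
  rewrite Rabs_pos_eq by (left; apply Rinv_0_lt_compat, pow_lt; lra).
  apply Rinv_le_contravar; [apply pow_lt; lra|]. apply Rle_pow; assumption.
Qed.

Lemma is_series_zeta (s : nat) :
  (2 <= s)%nat -> is_series (fun m => / INR (S m) ^ s) (zeta (INR s)).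
Proof.
  intros Hs. unfold zeta. rewrite (Series_ext _ (fun m => / INR (S m) ^ s)).
  - apply Series_correct, ex_series_inv_pow, Hs.
  - intros m. assert (0 < INR (S m)) by (apply lt_0_INR; lia).
    rewrite Rpower_Ropp, Rpower_pow by assumption. reflexivity.
Qed.

Lemma Si_0 : Si 0 = 0.
Proof.
  unfold Si. rewrite (RInt_ext _ (fun _ => 1)).
  - rewrite RInt_const. change (PI / 2 - (PI / 2 - 0) * 1 = 0). ring.
  - intros v _. rewrite !Rmult_0_l, Ropp_0, exp_0, cos_0. exact (Rmult_1_r 1).
Qed.

Definition sine_coeff (n m : nat) : R :=
  (-1) ^ n * (2 / (2 * PI) ^ S (2 * n)) * / INR (S m) ^ S (2 * n).

Lemma bernoulli_fourier_even (n N : nat) (x : R) :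
  bernoulli_fourier (2 * n) N x
  = sum_f_R0 (fun m => sine_coeff n m * sin (2 * PI * INR (S m) * x)) N.
Proof.
  apply sum_eq. intros m _. unfold sine_coeff.
  replace (INR (2 * n) * (PI / 2)) with (INR n * PI)
    by (rewrite mult_INR; simpl; field).
  replace (sin (2 * PI * INR (S m) * x + INR n * PI))
    with ((-1) ^ n * sin (2 * PI * INR (S m) * x)).
  - rewrite Rpow_mult_distr. field. pose proof PI_RGT_0.
    pose proof (INR_S_pos m). split; apply pow_nonzero; lra.
  - induction n as [|n IH].
    { change (INR 0) with 0. rewrite Rmult_0_l, Rplus_0_r, pow_O. ring. }
    rewrite (S_INR n). replace (_ + (INR n + 1) * PI)
      with (2 * PI * INR (S m) * x + INR n * PI + PI) by ring.
    rewrite neg_sin, <- IH. cbn [pow]. ring.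
Qed.

(** Convergence of the Fourier sums at 0. This is the source of the vanishing of Bernoulli numbers
    of odd index at least 3. *)
Lemma appell_odd_0 (beta : nat -> R) (k : nat) :
  bernoulli_like beta -> (forall N, bernoulli_fourier (S k) N 0 = 0) ->
  appell beta (S (S k)) 0 = 0.
Proof.
  intros Hb H0.
  assert (H : Rbar_le (Rabs (appell beta (S (S k)) 0)) 0).
  { apply (is_lim_seq_le (fun _ => Rabs (appell beta (S (S k)) 0)) fourier_rate);
      [|apply is_lim_seq_const|apply fourier_rate_lim].
    intros N. pose proof (fourier_error_bound beta k N Hb 0 ltac:(lra)) as H.
    unfold fourier_error in H. rewrite H0, Rminus_0_r in H. exact H. }
  simpl in H. pose proof (Rabs_pos (appell beta (S (S k)) 0)).
  destruct (Req_dec (appell beta (S (S k)) 0) 0) as [E|E]; [exact E|].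
  apply Rabs_pos_lt in E. lra.
Qed.

(** The factor [x] is there to survive division by [x] on the first unit interval. It comes from
    integrating the previous error from 0, where polynomial and sine sum both vanish. *)
Lemma fourier_error_even_linear (beta : nat -> R) (n N : nat) (x : R) :
  bernoulli_like beta -> (1 <= n)%nat -> 0 <= x <= 1 ->
  Rabs (fourier_error beta (2 * n) N x) <= fourier_rate N * x.
Proof.
  intros Hb Hn Hx.
  assert (F0 : forall N', bernoulli_fourier (2 * n) N' 0 = 0).
  { intros N'. rewrite bernoulli_fourier_even. apply sum_eq_R0. intros m _.
    rewrite Rmult_0_r, sin_0. ring. }
  destruct n as [|n]; [lia|].
  replace (2 * S n)%nat with (S (S (2 * n))) in * by lia.
  assert (E0 : fourier_error beta (S (S (2 * n))) N 0 = 0).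
  { unfold fourier_error. rewrite appell_odd_0, F0; [ring|exact Hb|exact F0]. }
  replace (fourier_error _ _ _ x) with
    (fourier_error beta (S (S (2 * n))) N x - fourier_error beta (S (S (2 * n))) N 0)
    by (rewrite E0; ring).
  replace (fourier_rate N * x) with (fourier_rate N * x - fourier_rate N * 0) by ring.
  apply (increment_le_of_derive_le (fourier_error beta (S (S (2 * n))) N)
    (fun y => fourier_rate N * y) (fun y => - fourier_error beta (S (2 * n)) N y)
    (fun _ => fourier_rate N)); [lra| | | | |].
  - intros y _. apply (ex_derive_continuous (V := R_NormedModule)).
    eexists. apply is_derive_fourier_error.
  - intros y _. apply (ex_derive_continuous (V := R_NormedModule)). auto_derive. trivial.
  - intros y _. apply is_derive_fourier_error.
  - intros y _. auto_derive; [trivial|ring].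
  - intros y Hy. rewrite Rabs_Ropp. apply fourier_error_bound; [exact Hb|lra].
Qed.

(** As a function of the upper limit [x], the difference has derivative the Fourier error over
    [x + k], at most the rate even for [k = 0] by the linear bound. The quotient enters as a
    function [q] continuous on [x > -1]: dividing literally by [x] would fail at 0, and
    differentiating the integral there needs a neighbourhood. *)
Lemma RInt_quotient_approx (beta : nat -> R) (n N k : nat) (q : R -> R) :
  bernoulli_like beta -> (1 <= n)%nat ->
  (forall x, -1 < x -> continuous q x) ->
  (forall x, 0 < x < 1 -> (x + INR k) * q x = appell beta (S (2 * n)) x) ->
  Rabs (RInt q 0 1 - sum_f_R0 (fun m => sine_coeff n m *
    (Si (2 * PI * INR (S m) * (1 + INR k)) - Si (2 * PI * INR (S m) * (0 + INR k)))) N)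
  <= fourier_rate N.
Proof.
  intros Hb Hn Cq Hq.
  pose (Ss := fun x => sum_f_R0
    (fun m => sine_coeff n m * Si (2 * PI * INR (S m) * (x + INR k))) N).
  pose (dS := fun x => sum_f_R0
    (fun m => sine_coeff n m *
       (2 * PI * INR (S m) * dSi (2 * PI * INR (S m) * (x + INR k)))) N).
  pose (G := fun x => RInt q 0 x - Ss x).
  replace (RInt q 0 1 - _) with (G 1 - G 0).
  2:{ unfold G. rewrite RInt_point. change zero with 0.
      replace (RInt q 0 1 - Ss 1 - (0 - Ss 0)) with (RInt q 0 1 - (Ss 1 - Ss 0)) by ring.
      f_equal. unfold Ss. rewrite <- minus_sum. apply sum_eq. intros. ring. }
  assert (DG : forall x, -1 < x -> is_derive G x (q x - dS x)).
  { intros x Hx. apply (is_derive_minus (fun y => RInt q 0 y) Ss).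
    - apply (is_derive_RInt q (fun y => RInt q 0 y) 0).
      + generalize (open_gt (-1) x Hx). apply filter_imp. intros y Hy.
        apply (RInt_correct (V := R_CompleteNormedModule)), ex_RInt_continuous.
        intros z Hz. apply Cq. revert Hz. unfold Rmin. destruct (Rle_dec 0 y); lra.
      + apply Cq, Hx.
    - apply (is_derive_sum_f_R0
        (fun m y => sine_coeff n m * Si (2 * PI * INR (S m) * (y + INR k)))
        (fun m y => sine_coeff n m *
           (2 * PI * INR (S m) * dSi (2 * PI * INR (S m) * (y + INR k))))).
      intros m _. set (a := 2 * PI * INR (S m)). clearbody a. apply is_derive_scal.
      apply (is_derive_comp Si (fun y => a * (y + INR k))).
      + apply is_derive_Si.
      + auto_derive; [trivial|ring]. }
  replace (fourier_rate N) with (fourier_rate N * 1 - fourier_rate N * 0) by ring.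
  apply (increment_le_of_derive_le G (fun y => fourier_rate N * y)
    (fun x => q x - dS x) (fun _ => fourier_rate N)); [lra| | | | |].
  - intros y Hy. apply (ex_derive_continuous (V := R_NormedModule)).
    eexists. apply DG. lra.
  - intros y _. apply (ex_derive_continuous (V := R_NormedModule)). auto_derive. trivial.
  - intros y Hy. apply DG. lra.
  - intros y _. auto_derive; [trivial|ring].
  - intros x Hx. pose proof (pos_INR k) as Hk.
    apply (Rmult_le_reg_l (x + INR k)); [lra|].
    rewrite <- (Rabs_pos_eq (x + INR k)) at 1 by lra. rewrite <- Rabs_mult.
    replace ((x + INR k) * (q x - dS x)) with (fourier_error beta (2 * n) N x).
    + eapply Rle_trans; [apply fourier_error_even_linear; [exact Hb|exact Hn|lra]|].
      pose proof (fourier_error_bound beta 0 N Hb 0 ltac:(lra)) as Hr.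
      pose proof (Rabs_pos (fourier_error beta 1 N 0)). nra.
    + unfold fourier_error. rewrite Rmult_minus_distr_l, Hq by exact Hx. f_equal.
      rewrite bernoulli_fourier_even. unfold dS. rewrite scal_sum.
      apply sum_eq. intros m _.
      (* By periodicity the sine at [x] equals the sine at [x + k], where [dSi] is evaluated. *)
      rewrite <- (sin_period _ (S m * k)).
      replace (2 * PI * INR (S m) * x + 2 * INR (S m * k) * PI)
        with (2 * PI * INR (S m) * (x + INR k)) by (rewrite mult_INR; ring).
      rewrite <- mul_dSi. ring.
Qed.

(** The [Si] differences telescope, starting from [Si 0 = 0], while the errors of the unit intervals
    add up. *)
Lemma sum_RInt_quotient_approx (beta : nat -> R) (n N K : nat) (q : nat -> R -> R) :
  bernoulli_like beta -> (1 <= n)%nat ->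
  (forall k x, -1 < x -> continuous (q k) x) ->
  (forall k x, 0 < x < 1 -> (x + INR k) * q k x = appell beta (S (2 * n)) x) ->
  Rabs (sum_f_R0 (fun k => RInt (q k) 0 1) K
        - sum_f_R0 (fun m => sine_coeff n m * Si (2 * PI * INR (S m) * (1 + INR K))) N)
  <= INR (S K) * fourier_rate N.
Proof.
  intros Hb Hn Cq Hq.
  pose proof (fun k => RInt_quotient_approx beta n N k (q k) Hb Hn (Cq k) (Hq k)) as H.
  induction K as [|K IH].
  - specialize (H 0%nat). cbn [sum_f_R0]. change (INR 1) with 1. rewrite Rmult_1_l.
    replace (sum_f_R0 _ N) with (sum_f_R0 (fun m => sine_coeff n m *
      (Si (2 * PI * INR (S m) * (1 + INR 0)) - Si (2 * PI * INR (S m) * (0 + INR 0)))) N);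
      [exact H|].
    apply sum_eq. intros m _. change (INR 0) with 0.
    rewrite Rplus_0_l, Rmult_0_r, Si_0, Rminus_0_r. reflexivity.
  - specialize (H (S K)). cbn [sum_f_R0]. rewrite (S_INR (S K)).
    replace (_ - _) with
      ((sum_f_R0 (fun k => RInt (q k) 0 1) K
        - sum_f_R0 (fun m => sine_coeff n m * Si (2 * PI * INR (S m) * (1 + INR K))) N)
       + (RInt (q (S K)) 0 1 - sum_f_R0 (fun m => sine_coeff n m *
            (Si (2 * PI * INR (S m) * (1 + INR (S K)))
             - Si (2 * PI * INR (S m) * (0 + INR (S K))))) N)).
    + eapply Rle_trans; [apply Rabs_triang|]. lra.
    + replace (sum_f_R0 (fun m => sine_coeff n m * (_ - _)) N) with
        (sum_f_R0 (fun m => sine_coeff n m * Si (2 * PI * INR (S m) * (1 + INR (S K)))) N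
         - sum_f_R0 (fun m => sine_coeff n m * Si (2 * PI * INR (S m) * (1 + INR K))) N);
        [ring|].
      rewrite <- minus_sum. apply sum_eq. intros m _. rewrite (S_INR K).
      replace (0 + (INR K + 1)) with (1 + INR K) by ring. ring.
Qed.

(** Since [2 * PI * INR (S m) >= 3], the 3 of [Si_bound] is absorbed and the bound is the same for
    every harmonic. *)
Lemma sum_sine_coeff_Si (n N K : nat) :
  Rabs (sum_f_R0 (fun m => sine_coeff n m * Si (2 * PI * INR (S m) * (1 + INR K))) N
        - PI / 2 * sum_f_R0 (sine_coeff n) N)
  <= / INR (S K) * sum_f_R0 (fun m => Rabs (sine_coeff n m)) N.
Proof.
  rewrite !scal_sum, <- minus_sum.
  eapply Rle_trans; [apply sum_f_R0_triangle|]. apply sum_Rle. intros m _.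
  rewrite <- Rmult_minus_distr_l, Rabs_mult.
  apply Rmult_le_compat_l; [apply Rabs_pos|].
  replace (1 + INR K) with (INR (S K)) by (rewrite S_INR; ring).
  pose proof (INR_S_pos K). pose proof PI2_3_2.
  assert (1 <= INR (S m)) by (rewrite S_INR; pose proof (pos_INR m); lra).
  assert (3 <= 2 * PI * INR (S m)) by nra.
  eapply Rle_trans; [apply Si_bound; nra|].
  replace (/ INR (S K)) with (3 / (3 * INR (S K))) by (field; lra).
  apply Rmult_le_compat_l; [lra|]. apply Rinv_le_contravar; nra.
Qed.

Lemma sum_RInt_quotient_zeta (beta : nat -> R) (n K : nat) (q : nat -> R -> R) :
  bernoulli_like beta -> (1 <= n)%nat ->
  (forall k x, -1 < x -> continuous (q k) x) ->
  (forall k x, 0 < x < 1 -> (x + INR k) * q k x = appell beta (S (2 * n)) x) ->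
  Rabs (sum_f_R0 (fun k => RInt (q k) 0 1) K
        - (-1) ^ n * zeta (INR (2 * n + 1)) / (2 ^ (2 * n + 1) * PI ^ (2 * n)))
  <= 2 / (2 * PI) ^ S (2 * n) * zeta (INR (2 * n + 1)) / INR (S K).
Proof.
  intros Hb Hn Cq Hq. pose proof PI_RGT_0 as Hpi.
  set (A := sum_f_R0 (fun k => RInt (q k) 0 1) K).
  remember (2 / (2 * PI) ^ S (2 * n)) as c eqn:Ec.
  assert (Hc : 0 < c) by (rewrite Ec; apply Rdiv_lt_0_compat; [lra|apply pow_lt; lra]).
  pose proof (is_series_zeta (2 * n + 1) ltac:(lia)) as Hz.
  replace (2 * n + 1)%nat with (S (2 * n)) in * by lia.
  set (z := zeta (INR (S (2 * n)))) in *.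
  set (zs := sum_f_R0 (fun m => / INR (S m) ^ S (2 * n))).
  assert (Lz : is_lim_seq zs z).
  { apply (is_lim_seq_ext (sum_n (fun m => / INR (S m) ^ S (2 * n))));
      [intros N; apply sum_n_Reals|exact Hz]. }
  assert (Hzs : forall N, zs N <= z).
  { apply is_lim_seq_incr_compare; [exact Lz|]. intros N. unfold zs. cbn [sum_f_R0].
    pose proof (Rinv_0_lt_compat _ (pow_lt _ (S (2 * n)) (INR_S_pos (S N)))). lra. }
  assert (Hs : forall N, sum_f_R0 (sine_coeff n) N = (-1) ^ n * c * zs N).
  { intros N. unfold zs. rewrite scal_sum. apply sum_eq. intros m _.
    unfold sine_coeff. rewrite <- Ec. ring. }
  assert (Ha : forall N, sum_f_R0 (fun m => Rabs (sine_coeff n m)) N = c * zs N).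
  { intros N. unfold zs. rewrite scal_sum. apply sum_eq. intros m _.
    unfold sine_coeff. rewrite <- Ec, !Rabs_mult, pow_1_abs, (Rabs_pos_eq c),
      Rabs_pos_eq; [ring| |lra].
    left. apply Rinv_0_lt_compat, pow_lt, INR_S_pos. }
  replace ((-1) ^ n * z / (2 ^ S (2 * n) * PI ^ (2 * n)))
    with (PI / 2 * ((-1) ^ n * c * z)).
  2:{ rewrite Ec, Rpow_mult_distr. cbn [pow]. field.
      repeat split; try apply pow_nonzero; lra. }
  (* With [K] fixed, [N] tends to infinity: the Fourier error disappears despite its factor [K + 1],
     and only the tail of the sine integral remains. *)
  assert (Hle : Rbar_le (Rabs (A - PI / 2 * ((-1) ^ n * c * z)))
                  (INR (S K) * 0 + c * z / INR (S K))).
  { apply (is_lim_seq_le (fun N => Rabs (A - PI / 2 * ((-1) ^ n * c * zs N)))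
             (fun N => INR (S K) * fourier_rate N + c * z / INR (S K))).
    - intros N.
      pose proof (sum_RInt_quotient_approx beta n N K q Hb Hn Cq Hq) as H1.
      pose proof (sum_sine_coeff_Si n N K) as H2. fold A in H1.
      rewrite Hs, Ha in H2.
      assert (H3 : / INR (S K) * (c * zs N) <= c * z / INR (S K)).
      { unfold Rdiv. rewrite Rmult_comm. apply Rmult_le_compat_r.
        - left. apply Rinv_0_lt_compat, INR_S_pos.
        - apply Rmult_le_compat_l; [lra|apply Hzs]. }
      apply Rabs_le. apply Rabs_le_between in H1. apply Rabs_le_between in H2. lra.
    - apply (is_lim_seq_abs _ (Finite (A - PI / 2 * ((-1) ^ n * c * z)))).
      apply is_lim_seq_minus'; [apply is_lim_seq_const|].
      apply (is_lim_seq_scal_l _ (PI / 2) (Finite ((-1) ^ n * c * z))).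
      apply (is_lim_seq_scal_l _ ((-1) ^ n * c) (Finite z)). exact Lz.
    - apply is_lim_seq_plus'; [|apply is_lim_seq_const].
      apply (is_lim_seq_scal_l _ (INR (S K)) (Finite 0)). apply fourier_rate_lim. }
  rewrite Rmult_0_r, Rplus_0_l in Hle. exact Hle.
Qed.

(** * Laplace transform of the Bernoulli polynomials *)

Definition appell_laplace (beta : nat -> R) (d : nat) (t : R) : R :=
  RInt (fun x => appell beta d x * exp (- (t * x))) 0 1.

Lemma continuous_appell (beta : nat -> R) (d : nat) (x : R) :
  continuous (appell beta d) x.
Proof.
  apply (ex_derive_continuous (V := R_NormedModule)). destruct d as [|d].
  - exists 0. apply (is_derive_ext (fun _ => beta 0%nat)).
    + intros y. unfold appell. simpl. field.
    + exact (is_derive_const (K := R_AbsRing) (V := R_NormedModule) _ x).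
  - eexists. apply is_derive_appell.
Qed.

Lemma continuous_appell_exp (beta : nat -> R) (d : nat) (t x : R) :
  continuous (fun y => appell beta d y * exp (- (t * y))) x.
Proof.
  apply (continuous_mult (appell beta d) (fun y => exp (- (t * y)))).
  - apply continuous_appell.
  - apply (ex_derive_continuous (V := R_NormedModule)). auto_derive. trivial.
Qed.

Lemma appell_laplace_0 (beta : nat -> R) (t : R) :
  bernoulli_like beta -> t * appell_laplace beta 0 t = 1 - exp (- t).
Proof.
  intros Hb.
  transitivity (RInt (fun x => t * (appell beta 0 x * exp (- (t * x)))) 0 1).
  { symmetry. apply (RInt_scal (fun x => appell beta 0 x * exp (- (t * x)))).
    apply (ex_RInt_continuous (V := R_CompleteNormedModule)).
    intros x _. apply continuous_appell_exp. }
  apply is_RInt_unique.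
  pose (G := fun x => - exp (- (t * x))).
  replace (1 - exp (- t)) with (G 1 - G 0).
  - apply (is_RInt_derive (V := R_CompleteNormedModule) G).
    + intros x _. unfold G, appell. simpl. rewrite (bernoulli_like_0 beta Hb).
      auto_derive; [trivial|field].
    + intros x _. apply (continuous_scal_r t
        (fun x => appell beta 0 x * exp (- (t * x)))), continuous_appell_exp.
  - unfold G. rewrite Rmult_0_r, Rmult_1_r, Ropp_0, exp_0. ring.
Qed.

(** Integration by parts: the combined integrand is the derivative in [x] of
    [- appell beta (S d) x * exp (- (t * x))]. *)
Lemma appell_laplace_succ (beta : nat -> R) (d : nat) (t : R) :
  appell_laplace beta d t + t * appell_laplace beta (S d) t
  = beta (S d) - appell beta (S d) 1 * exp (- t).
Proof.
  pose (f := fun d' x => appell beta d' x * exp (- (t * x))).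
  assert (Ef : forall d', ex_RInt (f d') 0 1).
  { intros d'. apply (ex_RInt_continuous (V := R_CompleteNormedModule)).
    intros x _. apply continuous_appell_exp. }
  transitivity (RInt (fun x => f d x + t * f (S d) x) 0 1).
  { transitivity (RInt (f d) 0 1 + RInt (fun x => t * f (S d) x) 0 1).
    - apply (f_equal (Rplus _)). symmetry. apply (RInt_scal (f (S d))), Ef.
    - symmetry. apply (RInt_plus (f d) (fun x => t * f (S d) x)); [apply Ef|].
      apply (ex_RInt_scal (f (S d))), Ef. }
  apply is_RInt_unique.
  replace (beta (S d) - _) with (- f (S d) 1 - - f (S d) 0).
  2:{ unfold f. rewrite appell_0, Rmult_0_r, Rmult_1_r, Ropp_0, exp_0. ring. }
  apply (is_RInt_derive (V := R_CompleteNormedModule) (fun x => - f (S d) x)).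
  - intros x _. replace (f d x + t * f (S d) x)
      with (- (- appell beta d x * exp (- (t * x))
              + appell beta (S d) x * (- t * exp (- (t * x))))) by (unfold f; ring).
    apply (is_derive_opp (f (S d))).
    apply (is_derive_mult (appell beta (S d)) (fun y => exp (- (t * y)))).
    + apply is_derive_appell.
    + auto_derive; [trivial|ring].
    + intros; apply Rmult_comm.
  - intros x _. apply (continuous_plus (f d) (fun y => t * f (S d) y)).
    + apply continuous_appell_exp.
    + apply (continuous_scal_r t (f (S d))), continuous_appell_exp.
Qed.

Lemma bernoulli_like_odd (beta : nat -> R) (n : nat) :
  bernoulli_like beta -> (1 <= n)%nat -> beta (S (2 * n)) = 0.
Proof.
  intros Hb Hn. rewrite <- appell_0.
  replace (2 * n)%nat with (S (2 * n - 1)) by lia.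
  apply appell_odd_0; [exact Hb|]. intros N.
  replace (S (2 * n - 1)) with (2 * n)%nat by lia.
  rewrite bernoulli_fourier_even. apply sum_eq_R0. intros m _.
  rewrite Rmult_0_r, sin_0. ring.
Qed.

(** Each integration by parts adds one Laurent term. From degree 2 on, the polynomial agrees at 0
    and 1, and the boundary terms combine into the factor [1 - exp (- t)]. *)
Lemma appell_laplace_closed_form (beta : nat -> R) (d : nat) (t : R) :
  bernoulli_like beta ->
  t ^ S (S d) * appell_laplace beta (S d) t
  = (-1) ^ d * (t - (1 - exp (- t)) * sum_f_R0 (fun j => beta j * t ^ j) (S d)).
Proof.
  intros Hb. induction d as [|d IH].
  - pose proof (appell_laplace_succ beta 0 t) as H. rewrite Hb in H. simpl Nat.eqb in H.
    pose proof (appell_laplace_0 beta t Hb) as H0.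
    rewrite (bernoulli_like_1 beta Hb) in H.
    simpl. rewrite (bernoulli_like_0 beta Hb), (bernoulli_like_1 beta Hb).
    replace (t * (t * 1) * appell_laplace beta 1 t) with
      (t * (appell_laplace beta 0 t + t * appell_laplace beta 1 t)
        - t * appell_laplace beta 0 t) by ring.
    rewrite H, H0. field.
  - pose proof (appell_laplace_succ beta (S d) t) as H. rewrite Hb in H.
    simpl Nat.eqb in H. rewrite Rminus_0_r in H.
    replace (t ^ S (S (S d)) * appell_laplace beta (S (S d)) t) with
      (t ^ S (S d) * (appell_laplace beta (S d) t + t * appell_laplace beta (S (S d)) t)
        - t ^ S (S d) * appell_laplace beta (S d) t) by (cbn [pow]; ring).
    rewrite H, IH, (tech5 _ (S d)).
    (* The new term has sign [+] where the formula asks for [(-1) ^ d]; for odd [d] its coefficient,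
       of index [d + 2], is zero. *)
    destruct (Nat.Even_or_Odd d) as [[m ->]|[m ->]].
    + cbn [pow]. rewrite pow_1_even. ring.
    + replace (S (S (2 * m + 1))) with (S (2 * S m)) by lia.
      rewrite (bernoulli_like_odd beta (S m) Hb ltac:(lia)). cbn [pow]. ring.
Qed.

Definition appell_sup (beta : nat -> R) (d : nat) : R :=
  sum_f_R0 (fun l => Rabs (beta (d - l)%nat)) d.

Lemma appell_le_sup (beta : nat -> R) (d : nat) (x : R) :
  0 <= x <= 1 -> Rabs (appell beta d x) <= appell_sup beta d.
Proof.
  intros Hx. eapply Rle_trans; [apply sum_f_R0_triangle|].
  apply sum_Rle. intros l _. rewrite Rabs_mult.
  rewrite <- (Rmult_1_r (Rabs (beta (d - l)%nat))) at 2.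
  apply Rmult_le_compat_l; [apply Rabs_pos|].
  unfold Rdiv. rewrite Rabs_mult, <- RPow_abs, Rabs_Ropp, (Rabs_pos_eq x) by lra.
  assert (1 <= INR (fact l)) by (apply (le_INR 1); pose proof (lt_O_fact l); lia).
  rewrite Rabs_pos_eq by (left; apply Rinv_0_lt_compat; lra).
  replace 1 with (1 * / 1) by field.
  apply Rmult_le_compat.
  - apply pow_le. lra.
  - left. apply Rinv_0_lt_compat. lra.
  - rewrite <- (pow1 l). apply pow_incr. lra.
  - apply Rinv_le_contravar; lra.
Qed.

(** [t] times the integral of [exp (- (t * x))] over [0, 1] is exactly [1 - exp (- t)]. *)
Lemma appell_laplace_bound (beta : nat -> R) (d : nat) (t : R) :
  0 < t -> Rabs (t * appell_laplace beta d t) <= appell_sup beta d * (1 - exp (- t)).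
Proof.
  intros Ht. pose (M := appell_sup beta d).
  assert (HM : 0 <= M).
  { eapply Rle_trans; [apply Rabs_pos|apply (appell_le_sup beta d 0); lra]. }
  rewrite Rabs_mult, (Rabs_pos_eq t) by lra.
  pose (G := fun x => - (M / t * exp (- (t * x)))).
  assert (H : Rabs (appell_laplace beta d t) <= G 1 - G 0).
  { apply (norm_RInt_le (V := R_NormedModule)
      (fun x => appell beta d x * exp (- (t * x))) (fun x => M * exp (- (t * x))) 0 1).
    - lra.
    - intros x Hx. change (norm ?y) with (Rabs y).
      rewrite Rabs_mult, (Rabs_pos_eq (exp _)) by (left; apply exp_pos).
      apply Rmult_le_compat_r; [left; apply exp_pos|]. apply appell_le_sup, Hx.
    - apply (RInt_correct (V := R_CompleteNormedModule)).
      apply (ex_RInt_continuous (V := R_CompleteNormedModule)).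
      intros x _. apply continuous_appell_exp.
    - apply (is_RInt_derive (V := R_CompleteNormedModule) G).
      + intros x _. unfold G. auto_derive; [trivial|field; lra].
      + intros x _. apply (ex_derive_continuous (V := R_NormedModule)).
        auto_derive. trivial. }
  apply Rle_trans with (t * (G 1 - G 0)); [apply Rmult_le_compat_l; lra|].
  unfold G. fold M. rewrite Rmult_0_r, Rmult_1_r, Ropp_0, exp_0. right. field. lra.
Qed.

(** * The kernel of the integral and its geometric expansion *)

Definition bose_kernel (beta : nat -> R) (d : nat) (t : R) : R :=
  exp (- t) / (1 - exp (- t)) * appell_laplace beta d t.

Lemma exp_opp_lt_1 (t : R) : 0 < t -> exp (- t) < 1.
Proof. intros Ht. rewrite <- exp_0. apply exp_increasing. lra. Qed.

(** The pole of [1 / (1 - exp (- t))] at 0 must cancel. One more integration by parts writes the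
    transform as two terms, each bounded by a multiple of [1 - exp (- t)]. *)
Lemma bose_kernel_bound (beta : nat -> R) (d : nat) (t : R) :
  bernoulli_like beta -> 0 < t ->
  Rabs (bose_kernel beta (S d) t)
  <= (Rabs (beta (S (S d))) + appell_sup beta (S (S d))) * exp (- t).
Proof.
  intros Hb Ht. pose proof (exp_opp_lt_1 t Ht) as H1. pose proof (exp_pos (- t)) as H0.
  assert (HU : Rabs (appell_laplace beta (S d) t)
    <= (Rabs (beta (S (S d))) + appell_sup beta (S (S d))) * (1 - exp (- t))).
  { pose proof (appell_laplace_succ beta (S d) t) as H. rewrite Hb in H.
    simpl Nat.eqb in H. rewrite Rminus_0_r in H.
    replace (appell_laplace beta (S d) t) with
      (beta (S (S d)) * (1 - exp (- t)) + - (t * appell_laplace beta (S (S d)) t)) by lra.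
    eapply Rle_trans; [apply Rabs_triang|].
    rewrite Rabs_mult, Rabs_Ropp, (Rabs_pos_eq (1 - _)) by lra.
    pose proof (appell_laplace_bound beta (S (S d)) t Ht). lra. }
  unfold bose_kernel. rewrite Rabs_mult, Rabs_pos_eq
    by (left; apply Rdiv_lt_0_compat; lra).
  replace (_ * exp (- t)) with (exp (- t) / (1 - exp (- t)) *
    ((Rabs (beta (S (S d))) + appell_sup beta (S (S d))) * (1 - exp (- t))))
    by (field; lra).
  apply Rmult_le_compat_l; [left; apply Rdiv_lt_0_compat; lra|exact HU].
Qed.

Lemma ex_derive_appell_laplace (beta : nat -> R) (d : nat) (t : R) :
  ex_derive (appell_laplace beta d) t.
Proof.
  eexists.
  apply (is_derive_RInt_continuous_param
    (fun s x => appell beta d x * exp (- (s * x)))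
    (fun s x => appell beta d x * (- x * exp (- (s * x))))).
  - intros x _. apply filter_forall. intros y s. apply is_derive_scal.
    auto_derive; [trivial|ring].
  - intros s x _. apply continuous_appell_exp.
  - intros x. apply continuity_2d_pt_mult.
    + apply (continuity_1d_2d_pt_comp (appell beta d) (fun _ v => v)).
      * apply continuity_pt_filterlim, continuous_appell.
      * apply continuity_2d_pt_id2.
    + apply continuity_2d_pt_mult.
      * apply continuity_2d_pt_opp, continuity_2d_pt_id2.
      * apply (continuity_1d_2d_pt_comp exp).
        -- apply derivable_continuous_pt, derivable_pt_exp.
        -- apply continuity_2d_pt_opp, continuity_2d_pt_mult;
             [apply continuity_2d_pt_id1|apply continuity_2d_pt_id2].
Qed.

(* [int_t^oo e^(-(k+1)s) (appell_laplace s) ds], with the order of the two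
   integrals exchanged. *)
Definition appell_tail (beta : nat -> R) (d k : nat) (t : R) : R :=
  RInt (fun x => appell beta d x * (exp (- (t * (x + INR (S k)))) / (x + INR (S k)))) 0 1.

Lemma is_derive_appell_tail (beta : nat -> R) (d k : nat) (t : R) :
  is_derive (appell_tail beta d k) t
    (- (exp (- (INR (S k) * t)) * appell_laplace beta d t)).
Proof.
  assert (Hk : 1 <= INR (S k)) by (rewrite S_INR; pose proof (pos_INR k); lra).
  pose (f := fun s x => appell beta d x * (exp (- (s * (x + INR (S k)))) / (x + INR (S k)))).
  pose (df := fun s x => - exp (- (INR (S k) * s)) * (appell beta d x * exp (- (s * x)))).
  replace (- _) with (RInt (df t) 0 1).
  2:{ rewrite Ropp_mult_distr_l.
      apply (RInt_scal (fun x => appell beta d x * exp (- (t * x)))).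
      apply (ex_RInt_continuous (V := R_CompleteNormedModule)).
      intros x _. apply continuous_appell_exp. }
  assert (Hm : forall x, Rmin 0 1 <= x <= Rmax 0 1 -> 0 <= x <= 1)
    by (intros x; rewrite Rmin_left, Rmax_right by lra; trivial).
  apply (is_derive_RInt_continuous_param f df).
  - intros x Hx. apply Hm in Hx.
    (* For [y > -1] the denominator [y + INR (S k)] stays positive. *)
    generalize (open_gt (-1) x ltac:(lra)). apply filter_imp. intros y Hy s.
    unfold f, df.
    replace (- _ * (_ * _)) with
      (appell beta d y * (- exp (- (INR (S k) * s)) * exp (- (s * y)))) by ring.
    apply is_derive_scal. set (a := INR (S k)) in *. clearbody a.
    rewrite <- Ropp_mult_distr_l, <- exp_plus.
    replace (- (a * s) + - (s * y)) with (- (s * (y + a))) by ring.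
    auto_derive; [trivial|]. field. lra.
  - intros s x Hx. apply Hm in Hx. apply (continuous_mult (appell beta d)).
    + apply continuous_appell.
    + apply (ex_derive_continuous (V := R_NormedModule)). set (a := INR (S k)) in *.
      clearbody a. auto_derive. lra.
  - intros x. unfold df.
    assert (Ke : forall y, continuity_pt exp y)
      by (intros y; apply derivable_continuous_pt, derivable_pt_exp).
    apply continuity_2d_pt_mult; [|apply continuity_2d_pt_mult].
    + apply continuity_2d_pt_opp. apply (continuity_1d_2d_pt_comp exp); [apply Ke|].
      apply continuity_2d_pt_opp, continuity_2d_pt_mult;
        [apply continuity_2d_pt_const|apply continuity_2d_pt_id1].
    + apply (continuity_1d_2d_pt_comp (appell beta d) (fun _ v => v)).
      * apply continuity_pt_filterlim, continuous_appell.
      * apply continuity_2d_pt_id2.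
    + apply (continuity_1d_2d_pt_comp exp); [apply Ke|].
      apply continuity_2d_pt_opp, continuity_2d_pt_mult;
        [apply continuity_2d_pt_id1|apply continuity_2d_pt_id2].
Qed.

Lemma appell_tail_bound (beta : nat -> R) (d k : nat) (t : R) :
  0 <= t -> Rabs (appell_tail beta d k t) <= appell_sup beta d * exp (- t).
Proof.
  intros Ht. rewrite <- (Rmult_1_l (appell_sup beta d * exp (- t))).
  rewrite <- (Rminus_0_r 1) at 1.
  assert (Hk : 1 <= INR (S k)) by (rewrite S_INR; pose proof (pos_INR k); lra).
  apply abs_RInt_le_const; [lra| |].
  - apply (ex_RInt_continuous (V := R_CompleteNormedModule)).
    intros x. rewrite Rmin_left, Rmax_right by lra. intros Hx.
    apply (continuous_mult (appell beta d)); [apply continuous_appell|].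
    apply (ex_derive_continuous (V := R_NormedModule)). set (a := INR (S k)) in *.
    clearbody a. auto_derive. lra.
  - intros x Hx. rewrite Rabs_mult.
    apply Rmult_le_compat; try apply Rabs_pos; [apply appell_le_sup, Hx|].
    rewrite Rabs_pos_eq by (left; apply Rdiv_lt_0_compat; [apply exp_pos|lra]).
    apply Rle_div_l; [lra|]. pose proof (exp_pos (- t)).
    apply Rle_trans with (exp (- t)); [|nra].
    apply exp_le_compat. nra.
Qed.

Lemma continuous_bose_kernel (beta : nat -> R) (d : nat) (t : R) :
  0 < t -> continuous (bose_kernel beta d) t.
Proof.
  intros Ht. pose proof (exp_opp_lt_1 t Ht).
  apply (continuous_mult (fun s => exp (- s) / (1 - exp (- s))) (appell_laplace beta d)).
  - apply (ex_derive_continuous (V := R_NormedModule)). auto_derive.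
    repeat split; try lra.
  - apply (ex_derive_continuous (V := R_NormedModule)), ex_derive_appell_laplace.
Qed.

Lemma geometric_exp_sum (K : nat) (t : R) :
  (1 - exp (- t)) * sum_f_R0 (fun k => exp (- (INR (S k) * t))) K
  = exp (- t) * (1 - exp (- (INR (S K) * t))).
Proof.
  induction K as [|K IH]; cbn [sum_f_R0].
  - change (INR 1) with 1. rewrite Rmult_1_l. ring.
  - rewrite Rmult_plus_distr_l, IH, (S_INR (S K)).
    replace (- ((INR (S K) + 1) * t)) with (- (INR (S K) * t) + - t) by ring.
    rewrite exp_plus. ring.
Qed.

(** Integral plus tails, differentiated in the upper limit, leave only the remainder of the
    geometric series: [exp (- (INR (S K) * t))] times the kernel. As the kernel is bounded, this
    integrates to [O(1 / (K + 1))], whatever [a] and [T]. *)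
Lemma RInt_bose_kernel_approx (beta : nat -> R) (d K : nat) (a T : R) :
  bernoulli_like beta -> 0 < a <= T ->
  Rabs (RInt (bose_kernel beta (S d)) a T
        - (sum_f_R0 (fun k => appell_tail beta (S d) k a) K
           - sum_f_R0 (fun k => appell_tail beta (S d) k T) K))
  <= (Rabs (beta (S (S d))) + appell_sup beta (S (S d))) / INR (S K).
Proof.
  intros Hb HaT. set (B := Rabs (beta (S (S d))) + appell_sup beta (S (S d))).
  assert (HB : 0 <= B).
  { pose proof (bose_kernel_bound beta d 1 Hb ltac:(lra)) as H. fold B in H.
    pose proof (Rabs_pos (bose_kernel beta (S d) 1)). pose proof (exp_pos (- (1))). nra. }
  set (f := bose_kernel beta (S d)).
  pose proof (INR_S_pos K) as HK.
  pose (Y := fun t => RInt f a t + sum_f_R0 (fun k => appell_tail beta (S d) k t) K).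
  pose (dY := fun t => exp (- (INR (S K) * t)) * f t).
  pose (G := fun t => - (B / INR (S K) * exp (- (INR (S K) * t)))).
  assert (DY : forall t, a <= t <= T -> is_derive Y t (dY t)).
  { intros t Ht. pose proof (exp_opp_lt_1 t ltac:(lra)) as He.
    replace (dY t) with (f t + sum_f_R0 (fun k =>
      - (exp (- (INR (S k) * t)) * appell_laplace beta (S d) t)) K).
    - apply (is_derive_plus (fun s => RInt f a s)).
      + apply (is_derive_RInt f (fun s => RInt f a s) a);
          [|apply continuous_bose_kernel; lra].
        generalize (open_gt 0 t ltac:(lra)). apply filter_imp. intros s Hs.
        apply (RInt_correct (V := R_CompleteNormedModule)).
        apply (ex_RInt_continuous (V := R_CompleteNormedModule)).
        intros z Hz. apply continuous_bose_kernel. revert Hz.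
        unfold Rmin. destruct (Rle_dec a s); lra.
      + apply (is_derive_sum_f_R0 (fun k s => appell_tail beta (S d) k s)
          (fun k s => - (exp (- (INR (S k) * s)) * appell_laplace beta (S d) s))).
        intros k _. apply is_derive_appell_tail.
    - replace (sum_f_R0 _ K) with
        (- appell_laplace beta (S d) t * sum_f_R0 (fun k => exp (- (INR (S k) * t))) K)
        by (rewrite scal_sum; apply sum_eq; intros; ring).
      pose proof (geometric_exp_sum K t) as Hg.
      replace (sum_f_R0 _ K) with
        (exp (- t) * (1 - exp (- (INR (S K) * t))) / (1 - exp (- t)))
        by (rewrite <- Hg; field; lra).
      unfold dY, f, bose_kernel. field. lra. }
  assert (DG : forall t, is_derive G t (B * exp (- (INR (S K) * t)))).
  { intros t. unfold G. set (c := INR (S K)) in *. clearbody c.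
    auto_derive; [trivial|]. field. lra. }
  assert (H : Rabs (Y T - Y a) <= G T - G a).
  { apply (increment_le_of_derive_le Y G dY (fun t => B * exp (- (INR (S K) * t))));
      [lra| | | | |].
    - intros t Ht. apply (ex_derive_continuous (V := R_NormedModule)).
      eexists. apply DY, Ht.
    - intros t _. apply (ex_derive_continuous (V := R_NormedModule)). eexists. apply DG.
    - intros t Ht. apply DY. lra.
    - intros t _. apply DG.
    - intros t Ht. unfold dY.
      rewrite Rabs_mult, (Rabs_pos_eq (exp _)), Rmult_comm by (left; apply exp_pos).
      apply Rmult_le_compat_r; [left; apply exp_pos|].
      eapply Rle_trans; [apply bose_kernel_bound; [exact Hb|lra]|]. fold B.
      pose proof (exp_opp_lt_1 t ltac:(lra)). nra. }
  replace (RInt f a T - _) with (Y T - Y a).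
  2:{ unfold Y. rewrite RInt_point. change zero with 0. ring. }
  eapply Rle_trans; [exact H|]. unfold G.
  pose proof (exp_pos (- (INR (S K) * T))).
  assert (exp (- (INR (S K) * a)) <= 1)
    by (rewrite <- exp_0; apply exp_le_compat; nra).
  assert (0 <= B / INR (S K)) by (apply Rdiv_le_0_compat; lra). nra.
Qed.

Lemma is_RInt_gen_bose_kernel (beta : nat -> R) (d : nat) (I C : R) :
  bernoulli_like beta ->
  (forall K, Rabs (sum_f_R0 (fun k => appell_tail beta (S d) k 0) K - I) <= C / INR (S K)) ->
  is_RInt_gen (bose_kernel beta (S d)) (at_right 0) (Rbar_locally p_infty) I.
Proof.
  intros Hb HI P [e He].
  set (B := Rabs (beta (S (S d))) + appell_sup beta (S (S d))).
  (* Uniformity in [a] and [T] allows [K] to be fixed first. The finite sum [H] is then handled by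
     continuity at 0 and decay at infinity: three errors, each below [e / 4]. *)
  destruct (INR_unbounded (4 * (B + C) / e)) as [K HK].
  pose proof (INR_S_pos K) as HSK.
  assert (Hrem : (B + C) / INR (S K) < e / 4).
  { apply Rlt_div_l; [exact HSK|].
    assert (E : 4 * (B + C) < INR (S K) * e).
    { apply Rlt_div_l; [apply cond_pos|]. rewrite S_INR. lra. }
    lra. }
  pose (H := fun t => sum_f_R0 (fun k => appell_tail beta (S d) k t) K).
  assert (CH : continuous H 0).
  { apply (ex_derive_continuous (V := R_NormedModule)). eexists.
    apply (is_derive_sum_f_R0 (fun k t => appell_tail beta (S d) k t)
      (fun k s => - (exp (- (INR (S k) * s)) * appell_laplace beta (S d) s))).
    intros k _. apply is_derive_appell_tail. }
  assert (e4 : 0 < e / 4) by (pose proof (cond_pos e); lra).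
  set (M := INR (S K) * appell_sup beta (S d)).
  assert (HM : 0 <= M).
  { apply Rmult_le_pos; [lra|].
    eapply Rle_trans; [apply Rabs_pos|apply (appell_le_sup beta (S d) 0); lra]. }
  assert (HT : forall T, 0 <= T -> Rabs (H T) <= M * exp (- T)).
  { intros T HT. eapply Rle_trans; [apply sum_f_R0_triangle|].
    replace (M * exp (- T)) with (sum_f_R0 (fun _ => appell_sup beta (S d) * exp (- T)) K)
      by (rewrite sum_cte; unfold M; ring).
    apply sum_Rle. intros k _. apply appell_tail_bound, HT. }
  apply (Filter_prod _ _ _
    (fun a => 0 < a < 1 /\ Rabs (H a - H 0) < e / 4)
    (fun T => 1 < T /\ 4 * M / e < T)).
  - pose proof (CH _ (locally_ball (H 0) (mkposreal _ e4))) as Ha.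
    unfold filtermap in Ha.
    assert (H1 : locally 0 (fun a : R => a < 1)) by (apply (open_lt 1 0); lra).
    unfold at_right, within. generalize (filter_and _ _ H1 Ha). apply filter_imp.
    intros a [Ha1 Ha2] Ha0. split; [lra|exact Ha2].
  - apply filter_and.
    + exists 1. trivial.
    + exists (4 * M / e). trivial.
  - intros a T [Ha1 Ha2] [HT1 HT2]. exists (RInt (bose_kernel beta (S d)) a T). split.
    + apply (RInt_correct (V := R_CompleteNormedModule)).
      apply (ex_RInt_continuous (V := R_CompleteNormedModule)).
      intros z. cbn [fst snd]. rewrite Rmin_left, Rmax_right by lra. intros Hz.
      apply continuous_bose_kernel. lra.
    + apply He. change (Rabs (RInt (bose_kernel beta (S d)) a T - I) < e).
      pose proof (RInt_bose_kernel_approx beta d K a T Hb ltac:(lra)) as H1.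
      fold B in H1. fold (H a) (H T) in H1.
      specialize (HI K). fold (H 0) in HI.
      assert (H2 : Rabs (H T) < e / 4).
      { eapply Rle_lt_trans; [apply HT; lra|].
        apply Rlt_div_l in HT2; [|apply cond_pos].
        (* [1 + T <= exp T] trades the exponential decay for [1 / T], which fits the threshold
           [4 * M / e]. *)
        assert (HE : exp (- T) * T <= 1).
        { pose proof (exp_ineq1_le T). pose proof (exp_pos (- T)).
          assert (exp (- T) * exp T = 1) by (rewrite <- exp_plus, Rplus_opp_l; apply exp_0).
          nra. }
        pose proof (exp_pos (- T)). pose proof (cond_pos e). nra. }
      replace ((B + C) / INR (S K)) with (B / INR (S K) + C / INR (S K)) in Hrem
        by (field; lra).
      apply Rabs_lt_between. apply Rabs_le_between in H1. apply Rabs_le_between in HI.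
      apply Rabs_lt_between in H2. apply Rabs_lt_between in Ha2. lra.
Qed.

(** * Laurent coefficients and the rational constant *)

Lemma le_CV_radius_of_is_pseries (a : nat -> R) (x l : R) :
  is_pseries a x l -> Rbar_le (Rabs x) (CV_radius a).
Proof.
  intros H. apply is_pseries_R in H. apply Rbar_not_lt_le. intros Hlt.
  apply (CV_disk_outside a x Hlt). apply ex_series_lim_0. exists l. exact H.
Qed.

Lemma is_pseries_one_minus_exp (t : R) :
  is_pseries (fun k => (if Nat.eqb k 0 then 1 else 0) - (-1) ^ k / INR (fact k)) t
    (1 - exp (- t)).
Proof.
  apply is_pseries_R, is_series_decr_1.
  apply (is_series_ext (fun k => scal (-1) (/ INR (fact (S k)) * (- t) ^ S k))).
  - intros k. change (scal ?x ?y) with (x * y). simpl Nat.eqb. cbn match.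
    replace (- t) with (-1 * t) by ring. rewrite Rpow_mult_distr.
    match goal with |- ?x = ?y => change (@eq R x y) end. unfold Rdiv. ring.
  - replace (plus _ _) with (scal (-1) (exp (- t) - 1)).
    2:{ unfold plus, opp, scal; simpl; unfold mult; simpl. field. }
    apply (is_series_scal (V := R_NormedModule) (-1)).
    apply (is_series_incr_1 (fun k => / INR (fact k) * (- t) ^ k)).
    replace (plus _ _) with (exp (- t)) by (unfold plus; simpl; field).
    apply is_pseries_R, is_exp_Reals.
Qed.

Lemma is_pseries_id (t : R) : is_pseries (fun k => if Nat.eqb k 1 then 1 else 0) t t.
Proof.
  apply is_pseries_R. apply (filterlim_ext_loc (fun _ => t)); [|apply filterlim_const].
  exists 1%nat. intros N HN. rewrite sum_n_Reals.
  induction N as [|N IH]; [lia|]. destruct N as [|N]; [simpl; ring|].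
  rewrite tech5, <- IH by lia. simpl Nat.eqb. cbn match. ring.
Qed.

Definition shifted_laurent (b : Z -> Q) (j : nat) : R := Q2R (b (Z.of_nat j - 1)%Z).

Lemma powerRZ_pred (t : R) (j : nat) :
  t <> 0 -> powerRZ t (Z.of_nat j - 1) = t ^ j / t.
Proof.
  intros Ht. unfold Z.sub. rewrite powerRZ_add, <- pow_powerRZ by exact Ht.
  simpl. field. exact Ht.
Qed.

(** The shifted series represents [t / (1 - exp (- t))]. Its Cauchy product with the series of
    [1 - exp (- t)] represents [t], and coefficients of power series are unique. *)
Lemma laurent_bernoulli_like (b : Z -> Q) :
  laurent_coefficients b -> bernoulli_like (shifted_laurent b).
Proof.
  intros (r & Hr & H). set (beta := shifted_laurent b).
  set (eps := fun k => (if Nat.eqb k 0 then 1 else 0) - (-1) ^ k / INR (fact k)).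
  assert (Hexp : forall t, t <> 0 -> 1 - exp (- t) <> 0).
  { intros t Ht E. apply Ht. assert (E' : exp (- t) = exp 0) by (rewrite exp_0; lra).
    apply exp_inv in E'. lra. }
  assert (Sb : forall t, 0 < Rabs t < r -> is_pseries beta t (t / (1 - exp (- t)))).
  { intros t Ht. assert (t <> 0) by (intros ->; rewrite Rabs_R0 in Ht; lra).
    apply is_pseries_R.
    apply (is_series_ext (fun j => scal t
      (Q2R (b (Z.of_nat j - 1)%Z) * powerRZ t (Z.of_nat j - 1)))).
    - intros j. rewrite powerRZ_pred by assumption.
      change (scal ?x ?y) with (x * y). unfold beta, shifted_laurent.
      match goal with |- ?x = ?y => change (@eq R x y) end. field. assumption.
    - apply (is_series_scal (V := R_NormedModule) t). apply H, Ht. }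
  assert (Rb : Rbar_le (r / 2) (CV_radius beta)).
  { rewrite <- (Rabs_pos_eq (r / 2)) by lra.
    eapply le_CV_radius_of_is_pseries, Sb. rewrite Rabs_pos_eq; lra. }
  assert (Re : Rbar_le (r / 2) (CV_radius eps)).
  { rewrite <- (Rabs_pos_eq (r / 2)) by lra.
    eapply le_CV_radius_of_is_pseries, is_pseries_one_minus_exp. }
  assert (Sm : forall t, 0 < Rabs t < r / 2 -> is_pseries (PS_mult eps beta) t t).
  { intros t Ht. assert (t <> 0) by (intros ->; rewrite Rabs_R0 in Ht; lra).
    replace t with ((1 - exp (- t)) * (t / (1 - exp (- t)))) at 2
      by (field; apply Hexp; assumption).
    apply is_pseries_mult.
    - apply is_pseries_one_minus_exp.
    - apply Sb. lra.
    - eapply Rbar_lt_le_trans; [|exact Re]. apply Ht.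
    - eapply Rbar_lt_le_trans; [|exact Rb]. apply Ht. }
  assert (Hm : forall d, PS_mult eps beta d = (if Nat.eqb d 1 then 1 else 0)).
  { intros d. apply (PSeries_ext_recip _ (fun d => if Nat.eqb d 1 then 1 else 0)).
    - apply (Rbar_lt_le_trans _ (Rabs (r / 4))).
      + simpl. rewrite Rabs_pos_eq; lra.
      + eapply le_CV_radius_of_is_pseries, Sm. rewrite Rabs_pos_eq; lra.
    - apply (Rbar_lt_le_trans _ (Rabs 1)).
      + simpl. rewrite Rabs_R1. lra.
      + eapply le_CV_radius_of_is_pseries, is_pseries_id.
    - assert (Hr2 : 0 < r / 2) by lra. exists (mkposreal _ Hr2). intros t Ht.
      change (Rabs (t - 0) < r / 2) in Ht. rewrite Rminus_0_r in Ht.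
      (* The Laurent hypothesis is silent at [t = 0]; there the constant term of the product is 0
         because [eps 0 = 0]. *)
      destruct (Req_dec t 0) as [-> | Ht0].
      + rewrite !PSeries_0. unfold PS_mult, eps. simpl. field.
      + transitivity t; [|symmetry]; apply is_pseries_unique; [|apply is_pseries_id].
        apply Sm. split; [apply Rabs_pos_lt, Ht0|exact Ht]. }
  intros d. rewrite <- Hm.
  enough (E : PS_mult eps beta d + appell beta d 1 = beta d) by lra.
  unfold PS_mult, appell. rewrite <- sum_plus.
  destruct d as [|d]; [unfold eps; simpl; field|].
  rewrite decomp_sum by lia. rewrite sum_eq_R0.
  - unfold eps. simpl. field.
  - intros k _. unfold eps. simpl Nat.eqb. cbn match.
    replace (- (1)) with (-1) by ring. unfold Rdiv. ring.
Qed.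

Lemma Q2R_sign_over_fact (i : nat) :
  Q2R ((-1) ^ Z.of_nat (S i) / inject_Z (Z.of_nat (fact (S i))))
  = (-1) ^ S i / INR (fact (S i)).
Proof.
  rewrite (Qeq_eqR _ ((-1) * qa i)%Q).
  - rewrite Q2R_mult, Q2R_qa. replace (Q2R (-1)) with (-1) by (unfold Q2R; simpl; field).
    cbn [pow]. field. apply INR_fact_neq_0.
  - unfold qa. rewrite Nat2Z.inj_succ, <- Z.add_1_l, Qpower_plus by discriminate.
    unfold Qdiv. rewrite Qmult_assoc. reflexivity.
Qed.

Lemma Q2R_harmonic (i : nat) :
  Q2R (harmonic (S i)) = sum_f_R0 (fun j => / INR (S j)) i.
Proof.
  unfold harmonic, Qsum1. rewrite Q2R_fold_seq. apply sum_eq. intros j _.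
  cbn [Nat.add]. rewrite Q2R_inv.
  - f_equal. unfold Q2R, inject_Z. cbn [Qnum Qden]. rewrite <- INR_IZR_INZ. field.
  - unfold Qeq. cbn [Qnum Qden inject_Z]. lia.
Qed.

Lemma Q2R_c_const (b : Z -> Q) (n : nat) :
  Q2R (c_const b n) = sum_f_R0 (fun i => shifted_laurent b (2 * n - i)
    * ((-1) ^ S i / INR (fact (S i))) * sum_f_R0 (fun j => / INR (S j)) i) (2 * n).
Proof.
  unfold c_const, Qsum1. rewrite Nat.add_1_r, Q2R_fold_seq. apply sum_eq. intros i Hi.
  cbn [Nat.add]. rewrite !Q2R_mult, Q2R_harmonic, Q2R_sign_over_fact. do 2 f_equal.
  unfold shifted_laurent. do 2 f_equal. lia.
Qed.

(** The partial sums are sums of sines, odd about 1/2, and the limit inherits this. *)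
Lemma appell_odd_reflect (beta : nat -> R) (n : nat) (x : R) :
  bernoulli_like beta -> (1 <= n)%nat -> 0 <= x <= 1 ->
  appell beta (S (2 * n)) (1 - x) = - appell beta (S (2 * n)) x.
Proof.
  intros Hb Hn Hx. set (p := appell beta (S (2 * n))).
  assert (H : Rbar_le (Rabs (p (1 - x) + p x)) (2 * 0)).
  { apply (is_lim_seq_le (fun _ => Rabs (p (1 - x) + p x)) (fun N => 2 * fourier_rate N));
      [|apply is_lim_seq_const|
        apply (is_lim_seq_scal_l _ 2 (Finite 0)), fourier_rate_lim].
    intros N.
    assert (Hf : bernoulli_fourier (2 * n) N (1 - x) = -1 * bernoulli_fourier (2 * n) N x).
    { rewrite !bernoulli_fourier_even, scal_sum. apply sum_eq. intros m _.
      replace (2 * PI * INR (S m) * (1 - x))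
        with (- (2 * PI * INR (S m) * x) + 2 * INR (S m) * PI) by ring.
      rewrite sin_period, sin_neg. ring. }
    pose proof (fourier_error_bound beta (2 * n - 1) N Hb) as H.
    replace (S (2 * n - 1)) with (2 * n)%nat in H by lia.
    pose proof (H x Hx) as H1. pose proof (H (1 - x) ltac:(lra)) as H2.
    unfold fourier_error in H1, H2. rewrite Hf in H2. fold p in H1, H2.
    apply Rabs_le. apply Rabs_le_between in H1. apply Rabs_le_between in H2. lra. }
  rewrite Rmult_0_r in H. simpl in H.
  assert (E : p (1 - x) + p x = 0).
  { destruct (Req_dec (p (1 - x) + p x) 0) as [E|E]; [exact E|].
    apply Rabs_pos_lt in E. lra. }
  lra.
Qed.

(** The inner sums are [(1 - u ^ S i) / (1 - u)] at [u = 1 - x], expanded so that nothing is divided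
    by 0 at [x = 0]. *)
Definition appell_quotient (beta : nat -> R) (n : nat) (x : R) : R :=
  sum_f_R0 (fun i => beta (2 * n - i)%nat * ((-1) ^ S i / INR (fact (S i)))
    * sum_f_R0 (fun j => (1 - x) ^ j) i) (2 * n).

(* Since [appell (2n+1)] vanishes at 1 and is odd about 1/2, its quotient by [x] is
   its difference quotient between [1] and [1 - x]; this is where the harmonic
   numbers in [c_const] come from. *)
Lemma mul_appell_quotient (beta : nat -> R) (n : nat) (x : R) :
  bernoulli_like beta -> (1 <= n)%nat -> 0 < x < 1 ->
  x * appell_quotient beta n x = appell beta (S (2 * n)) x.
Proof.
  intros Hb Hn Hx.
  replace (appell beta (S (2 * n)) x)
    with (appell beta (S (2 * n)) 1 - appell beta (S (2 * n)) (1 - x)).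
  2:{ rewrite appell_odd_reflect by (assumption || lra). rewrite Hb.
      rewrite bernoulli_like_odd by assumption.
      replace (Nat.eqb (S (2 * n)) 1) with false; [ring|].
      symmetry. apply Nat.eqb_neq. lia. }
  unfold appell_quotient, appell. rewrite scal_sum, <- minus_sum.
  rewrite (decomp_sum _ (S (2 * n))) by lia. cbn [pred].
  rewrite !pow_O, Rminus_diag, Rplus_0_l.
  apply sum_eq. intros i _. rewrite tech3 by lra.
  change (S (2 * n) - S i)%nat with (2 * n - i)%nat.
  replace (- (1 - x)) with (-1 * (1 - x)) by ring. rewrite Rpow_mult_distr.
  replace (- (1)) with (-1) by ring. field. split; [apply INR_fact_neq_0|lra].
Qed.

Lemma continuous_sum_f_R0 (f : nat -> R -> R) (n : nat) (x : R) :
  (forall l, (l <= n)%nat -> continuous (f l) x) ->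
  continuous (fun y => sum_f_R0 (fun l => f l y) n) x.
Proof.
  induction n as [|n IH]; intros H; cbn [sum_f_R0]; [apply H; lia|].
  apply (continuous_plus (fun y => sum_f_R0 (fun l => f l y) n) (f (S n))).
  - apply IH. intros l Hl. apply H. lia.
  - apply H. lia.
Qed.

Lemma continuous_appell_quotient (beta : nat -> R) (n : nat) (x : R) :
  continuous (appell_quotient beta n) x.
Proof.
  apply (continuous_sum_f_R0 (fun i y => beta (2 * n - i)%nat
    * ((-1) ^ S i / INR (fact (S i))) * sum_f_R0 (fun j => (1 - y) ^ j) i)).
  intros i _. apply (continuous_scal_r _ (fun y => sum_f_R0 (fun j => (1 - y) ^ j) i)).
  apply (continuous_sum_f_R0 (fun j y => (1 - y) ^ j)). intros j _.
  apply (ex_derive_continuous (V := R_NormedModule)). auto_derive. trivial.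
Qed.

Lemma RInt_appell_quotient (b : Z -> Q) (n : nat) :
  RInt (appell_quotient (shifted_laurent b) n) 0 1 = Q2R (c_const b n).
Proof.
  set (beta := shifted_laurent b).
  pose (G := fun x => sum_f_R0 (fun i => beta (2 * n - i)%nat
    * ((-1) ^ S i / INR (fact (S i)))
    * sum_f_R0 (fun j => - ((1 - x) ^ S j / INR (S j))) i) (2 * n)).
  apply is_RInt_unique. rewrite Q2R_c_const. fold beta.
  replace (sum_f_R0 _ _) with (G 1 - G 0).
  2:{ unfold G. rewrite <- minus_sum. apply sum_eq. intros i _.
      rewrite <- Rmult_minus_distr_l, <- minus_sum. f_equal. apply sum_eq. intros j _.
      rewrite Rminus_diag, Rminus_0_r, pow1, pow_i by lia. unfold Rdiv. ring. }
  apply (is_RInt_derive (V := R_CompleteNormedModule) G).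
  - intros x _.
    apply (is_derive_sum_f_R0
      (fun i y => beta (2 * n - i)%nat * ((-1) ^ S i / INR (fact (S i)))
         * sum_f_R0 (fun j => - ((1 - y) ^ S j / INR (S j))) i)
      (fun i y => beta (2 * n - i)%nat * ((-1) ^ S i / INR (fact (S i)))
         * sum_f_R0 (fun j => (1 - y) ^ j) i)).
    intros i _. apply is_derive_scal.
    apply (is_derive_sum_f_R0 (fun j y => - ((1 - y) ^ S j / INR (S j)))
             (fun j y => (1 - y) ^ j)).
    intros j _. pose proof (INR_S_pos j). auto_derive; [trivial|].
    change (1 + - x) with (1 - x). change (match j with O => 1 | S _ => INR j + 1 end)
      with (INR (S j)). field. lra.
  - intros x _. apply continuous_appell_quotient.
Qed.

(** * The integral and the exponential period *)

Lemma sum_appell_tail_zeta (b : Z -> Q) (n K : nat) :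
  laurent_coefficients b -> (1 <= n)%nat ->
  Rabs (sum_f_R0 (fun k => appell_tail (shifted_laurent b) (S (2 * n)) k 0) K
    - ((-1) ^ n * zeta (INR (2 * n + 1)) / (2 ^ (2 * n + 1) * PI ^ (2 * n))
       - Q2R (c_const b n)))
  <= Rabs (2 / (2 * PI) ^ S (2 * n) * zeta (INR (2 * n + 1))) / INR (S K).
Proof.
  intros Hl Hn. pose proof (laurent_bernoulli_like b Hl) as Hb.
  set (beta := shifted_laurent b) in *.
  (* Index 0 is the division by [x] itself, whose integral is [c_const]; index [S k] gives
     [appell_tail] of index [k] at [t = 0]. *)
  pose (q := fun k x => match k with
    | O => appell_quotient beta n x
    | S _ => appell beta (S (2 * n)) x / (x + INR k) end).
  pose proof (sum_RInt_quotient_zeta beta n (S K) q Hb Hn) as H.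
  rewrite decomp_sum in H by lia. cbn [pred] in H.
  replace (RInt (q 0%nat) 0 1) with (Q2R (c_const b n)) in H
    by (symmetry; apply RInt_appell_quotient).
  replace (sum_f_R0 (fun k => RInt (q (S k)) 0 1) K)
    with (sum_f_R0 (fun k => appell_tail beta (S (2 * n)) k 0) K) in H.
  2:{ apply sum_eq. intros k _. apply RInt_ext. intros x _. unfold q.
      rewrite Rmult_0_l, Ropp_0, exp_0. unfold Rdiv.
      match goal with |- ?u = ?v => change (@eq R u v) end. ring. }
  match type of H with _ -> _ -> Rabs ?u <= _ => replace (Rabs _) with (Rabs u) end.
  2:{ f_equal. ring. }
  eapply Rle_trans; [apply H|].
  - intros [|k] x Hx; [apply continuous_appell_quotient|].
    assert (Hk : 1 <= INR (S k)) by (rewrite S_INR; pose proof (pos_INR k); lra).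
    apply (continuous_mult (appell beta (S (2 * n))) (fun y => / (y + INR (S k)))).
    + apply continuous_appell.
    + apply (ex_derive_continuous (V := R_NormedModule)).
      set (a := INR (S k)) in *. clearbody a. auto_derive. lra.
  - intros [|k] x Hx; unfold q.
    + change (INR 0) with 0. rewrite Rplus_0_r. apply mul_appell_quotient; assumption.
    + pose proof (INR_S_pos k). field. lra.
  (* The bound, used at [S K], has denominator [K + 2]; relaxing it to [K + 1] needs a nonnegative
     constant, hence the absolute value. *)
  - pose proof (INR_S_pos K). set (z := 2 / _ * _). rewrite (S_INR (S K)).
    apply Rle_trans with (Rabs z / (INR (S K) + 1)).
    + apply Rmult_le_compat_r; [left; apply Rinv_0_lt_compat; lra|apply Rle_abs].
    + apply Rmult_le_compat_l; [apply Rabs_pos|]. apply Rinv_le_contravar; lra.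
Qed.

(** The closed form for [d = 2 * n], where the sign is [+1] and the sum stops at index [2 * n + 1],
    that is, at [b_(2n)] after the shift. *)
Lemma laurent_integrand_eq (b : Z -> Q) (n : nat) (t : R) :
  laurent_coefficients b -> 0 < t ->
  1 / t ^ (2 * n) * (1 / (1 - exp (- t)) - laurent_partial_sum b (2 * n) t)
    * (exp (- t) / t)
  = bose_kernel (shifted_laurent b) (S (2 * n)) t.
Proof.
  intros Hl Ht. pose proof (exp_opp_lt_1 t Ht).
  pose proof (appell_laplace_closed_form (shifted_laurent b) (2 * n) t
                (laurent_bernoulli_like b Hl)) as H1.
  rewrite pow_1_even, Rmult_1_l in H1.
  assert (Hp : t ^ (2 * n) <> 0) by (apply pow_nonzero; lra).
  replace (laurent_partial_sum b (2 * n) t)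
    with (/ t * sum_f_R0 (fun j => shifted_laurent b j * t ^ j) (S (2 * n))).
  2:{ unfold laurent_partial_sum. rewrite scal_sum, Nat.add_1_r. apply sum_eq.
      intros j _. rewrite powerRZ_pred by lra. unfold shifted_laurent. field. lra. }
  set (s := sum_f_R0 _ _) in *. unfold bose_kernel.
  replace (appell_laplace _ _ t) with
    ((t - (1 - exp (- t)) * s) / (t * (t * t ^ (2 * n)))).
  2:{ rewrite <- H1. cbn [pow]. field. split; [exact Hp|lra]. }
  field. repeat split; try assumption; lra.
Qed.

Lemma is_RInt_gen_laurent (b : Z -> Q) (n : nat) :
  laurent_coefficients b -> (1 <= n)%nat ->
  is_RInt_gen
    (fun t => 1 / t ^ (2 * n)
       * (1 / (1 - exp (- t)) - laurent_partial_sum b (2 * n) t) * (exp (- t) / t))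
    (at_right 0) (Rbar_locally p_infty)
    ((-1) ^ n * zeta (INR (2 * n + 1)) / (2 ^ (2 * n + 1) * PI ^ (2 * n))
     - Q2R (c_const b n)).
Proof.
  intros Hl Hn. apply (is_RInt_gen_ext (bose_kernel (shifted_laurent b) (S (2 * n)))).
  - apply (Filter_prod _ _ _ (fun a => 0 < a) (fun T => 0 < T)).
    + exists (mkposreal 1 Rlt_0_1). intros a _ Ha. exact Ha.
    + exists 0. trivial.
    + intros a T Ha HT t Ht. cbn [fst snd] in Ht. symmetry.
      apply laurent_integrand_eq; [exact Hl|].
      eapply Rlt_trans; [|apply Ht]. apply Rmin_glb_lt; assumption.
  - eapply is_RInt_gen_bose_kernel; [apply laurent_bernoulli_like, Hl|].
    intros K. apply (sum_appell_tail_zeta b n K Hl Hn).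
Qed.

(** Serves to turn the rational constant into an integral of a member of the field. *)
Lemma is_RInt_gen_exp_opp :
  is_RInt_gen (fun t => exp (- t)) (at_right 0) (Rbar_locally p_infty) 1.
Proof.
  replace 1 with (0 - -1) by ring.
  assert (D : forall t, is_derive (fun u => - exp (- u)) t (exp (- t)))
    by (intros t; auto_derive; [trivial|ring]).
  apply (is_RInt_gen_ext (Derive (fun t => - exp (- t)))).
  - apply filter_forall. intros ab t _. apply is_derive_unique, D.
  - apply is_RInt_gen_Derive.
    + apply filter_forall. intros ab t _. eexists. apply D.
    + apply filter_forall. intros ab t _.
      apply (continuous_ext (fun u => exp (- u))).
      * intros u. symmetry. apply is_derive_unique, D.
      * apply (ex_derive_continuous (V := R_NormedModule)). auto_derive. trivial.
    + replace (-1) with (- exp (- 0)) by (rewrite Ropp_0, exp_0; ring).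
      eapply filterlim_filter_le_1.
      * apply (filter_le_within (F := locally 0)).
      * apply (ex_derive_continuous (V := R_NormedModule) (fun t => - exp (- t))).
        auto_derive. trivial.
    + replace 0 with (- 0) by ring.
      apply (filterlim_comp _ _ _ (fun t => exp (- t)) Ropp _ (locally 0) _).
      * apply (filterlim_comp _ _ _ Ropp exp _ (Rbar_locally m_infty)).
        -- apply (filterlim_Rbar_opp p_infty).
        -- apply is_lim_exp_m.
      * apply (filterlim_opp 0).
Qed.

(** * From real integrals to members of the field *)

Lemma is_RInt_gen_RtoC (g : R -> R) (l : R) (Fa Fb : (R -> Prop) -> Prop) :
  Filter Fa -> Filter Fb ->
  is_RInt_gen g Fa Fb l ->
  is_RInt_gen (V := C_R_NormedModule) (fun t => RtoC (g t)) Fa Fb (RtoC l).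
Proof.
  intros HFa HFb H P [e He].
  assert (HP : locally l (fun y : R => P (RtoC y))).
  { exists e. intros y Hy. apply He. split; [exact Hy|apply ball_center]. }
  specialize (H _ HP). revert H. unfold filtermapi. apply filter_imp.
  intros ab (y & Hy & HPy). exists (RtoC y). split; [|exact HPy].
  apply (is_RInt_fct_extend_pair (U := R_NormedModule) (V := R_NormedModule)).
  - exact Hy.
  - pose proof (is_RInt_const (V := R_NormedModule) (fst ab) (snd ab) 0) as H0.
    exact (eq_ind _ (is_RInt (V := R_NormedModule) (fun _ => 0) (fst ab) (snd ab)) H0
             _ (Rmult_0_r _)).
Qed.

(** Reduces membership in the field to real formulas. Equality can be demanded at every real [t],
    zeros of denominators included, because real and complex inverses both send 0 to 0. *)
Definition real_trace (G : (C -> C) -> Prop) (g : R -> R) : Prop :=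
  exists f, generated_field G f /\ forall t, f (RtoC t) = RtoC (g t).

Lemma real_trace_ext (G : (C -> C) -> Prop) (g h : R -> R) :
  (forall t, g t = h t) -> real_trace G g -> real_trace G h.
Proof.
  intros E (f & Hf & Ef). exists f. split; [exact Hf|]. intros t. now rewrite Ef, E.
Qed.

Lemma real_trace_rat (G : (C -> C) -> Prop) (q : Q) : real_trace G (fun _ => Q2R q).
Proof. eexists. split; [apply (gf_rat G q)|]. reflexivity. Qed.

Lemma real_trace_plus (G : (C -> C) -> Prop) (g h : R -> R) :
  real_trace G g -> real_trace G h -> real_trace G (fun t => g t + h t).
Proof.
  intros (f & Hf & Ef) (k & Hk & Ek). eexists. split; [apply (gf_add G f k Hf Hk)|].
  intros t. cbn beta. rewrite Ef, Ek. symmetry. apply RtoC_plus.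
Qed.

Lemma real_trace_opp (G : (C -> C) -> Prop) (g : R -> R) :
  real_trace G g -> real_trace G (fun t => - g t).
Proof.
  intros (f & Hf & Ef). eexists. split; [apply (gf_opp G f Hf)|].
  intros t. cbn beta. rewrite Ef. symmetry. apply RtoC_opp.
Qed.

Lemma real_trace_minus (G : (C -> C) -> Prop) (g h : R -> R) :
  real_trace G g -> real_trace G h -> real_trace G (fun t => g t - h t).
Proof.
  intros Hg Hh. apply (real_trace_plus G g (fun t => - h t) Hg), real_trace_opp, Hh.
Qed.

Lemma real_trace_mult (G : (C -> C) -> Prop) (g h : R -> R) :
  real_trace G g -> real_trace G h -> real_trace G (fun t => g t * h t).
Proof.
  intros (f & Hf & Ef) (k & Hk & Ek). eexists. split; [apply (gf_mul G f k Hf Hk)|].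
  intros t. cbn beta. rewrite Ef, Ek. symmetry. apply RtoC_mult.
Qed.

Lemma real_trace_inv (G : (C -> C) -> Prop) (g : R -> R) :
  real_trace G g -> real_trace G (fun t => / g t).
Proof.
  intros (f & Hf & Ef). eexists. split; [apply (gf_inv G f Hf)|].
  intros t. cbn beta. rewrite Ef. destruct (Req_dec (g t) 0) as [E|E].
  - rewrite E, Rinv_0. unfold Cinv, RtoC. cbn [fst snd]. f_equal; unfold Rdiv; ring.
  - symmetry. apply RtoC_inv, E.
Qed.

Lemma real_trace_div (G : (C -> C) -> Prop) (g h : R -> R) :
  real_trace G g -> real_trace G h -> real_trace G (fun t => g t / h t).
Proof.
  intros Hg Hh. apply (real_trace_mult G g (fun t => / h t) Hg), real_trace_inv, Hh.
Qed.

Lemma real_trace_nat (G : (C -> C) -> Prop) (k : nat) : real_trace G (fun _ => INR k).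
Proof.
  apply (real_trace_ext G (fun _ => Q2R (inject_Z (Z.of_nat k)))); [|apply real_trace_rat].
  intros _. unfold Q2R, inject_Z. cbn [Qnum Qden]. rewrite <- INR_IZR_INZ. field.
Qed.

Lemma real_trace_pow (G : (C -> C) -> Prop) (g : R -> R) (k : nat) :
  real_trace G g -> real_trace G (fun t => g t ^ k).
Proof.
  intros Hg. induction k as [|k IH]; [apply (real_trace_nat G 1)|].
  apply (real_trace_mult G g (fun t => g t ^ k) Hg IH).
Qed.

Lemma real_trace_sum (G : (C -> C) -> Prop) (g : nat -> R -> R) (N : nat) :
  (forall k, real_trace G (g k)) -> real_trace G (fun t => sum_f_R0 (fun k => g k t) N).
Proof.
  intros Hg. induction N as [|N IH]; [apply Hg|].
  apply (real_trace_plus G (fun t => sum_f_R0 (fun k => g k t) N)); [exact IH|apply Hg].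
Qed.

Lemma real_trace_powerRZ (G : (C -> C) -> Prop) (g : R -> R) (k : Z) :
  real_trace G g -> real_trace G (fun t => powerRZ (g t) k).
Proof.
  intros Hg. destruct k as [|p|p]; cbn [powerRZ].
  - apply (real_trace_nat G 1).
  - apply real_trace_pow, Hg.
  - apply (real_trace_inv G (fun t => g t ^ Pos.to_nat p)), real_trace_pow, Hg.
Qed.

Lemma exponential_period_of_real_trace (G : (C -> C) -> Prop) (g : R -> R) (l : R) :
  real_trace G g ->
  is_RInt_gen g (at_right 0) (Rbar_locally p_infty) l ->
  exponential_period (generated_field G) (RtoC l).
Proof.
  intros (f & Hf & Ef) Hg. exists f. split; [exact Hf|].
  apply (is_RInt_gen_ext (V := C_R_NormedModule) (fun t => RtoC (g t))).
  - apply filter_forall. intros ab t _. symmetry. apply Ef.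
  - apply is_RInt_gen_RtoC; [apply _|apply _|exact Hg].
Qed.

Lemma Cexp_RtoC (x : R) : Cexp (RtoC x) = RtoC (exp x).
Proof.
  unfold Cexp, RtoC. cbn [Re Im fst snd]. rewrite cos_0, sin_0. f_equal; ring.
Qed.

Lemma real_trace_laurent_integrand (b : Z -> Q) (n : nat) (q : Q) :
  real_trace (fun f => f = (fun t => t) \/ f = (fun t => Cexp (Copp t)))
    (fun t => (-1) ^ n * 2 ^ (2 * n + 1) *
      (1 / t ^ (2 * n) * (1 / (1 - exp (- t)) - laurent_partial_sum b (2 * n) t)
         * (exp (- t) / t) + Q2R q * exp (- t))).
Proof.
  set (G := fun f : C -> C => _).
  assert (Tid : real_trace G (fun t => t)).
  { exists (fun t => t). split; [apply gf_gen; left; reflexivity|]. reflexivity. }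
  assert (Texp : real_trace G (fun t => exp (- t))).
  { exists (fun t => Cexp (Copp t)). split; [apply gf_gen; right; reflexivity|].
    intros t. rewrite <- RtoC_opp. apply Cexp_RtoC. }
  assert (T1 : real_trace G (fun _ => 1)) by apply (real_trace_nat G 1).
  apply (real_trace_mult G (fun _ => (-1) ^ n * 2 ^ (2 * n + 1))).
  { apply (real_trace_mult G (fun _ => (-1) ^ n)).
    - apply (real_trace_pow G (fun _ => -1)), (real_trace_opp G (fun _ => 1)), T1.
    - apply (real_trace_pow G (fun _ => 2)), (real_trace_nat G 2). }
  apply (real_trace_plus G (fun t => 1 / t ^ (2 * n)
    * (1 / (1 - exp (- t)) - laurent_partial_sum b (2 * n) t) * (exp (- t) / t))).
  2:{ apply (real_trace_mult G (fun _ => Q2R q)); [apply real_trace_rat|exact Texp]. }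
  apply (real_trace_mult G (fun t => 1 / t ^ (2 * n)
    * (1 / (1 - exp (- t)) - laurent_partial_sum b (2 * n) t))).
  2:{ apply (real_trace_div G (fun t => exp (- t)) (fun t => t)); assumption. }
  apply (real_trace_mult G (fun t => 1 / t ^ (2 * n))).
  { apply (real_trace_div G (fun _ => 1)); [exact T1|]. apply real_trace_pow, Tid. }
  apply (real_trace_minus G (fun t => 1 / (1 - exp (- t)))).
  { apply (real_trace_div G (fun _ => 1)); [exact T1|].
    apply (real_trace_minus G (fun _ => 1)); assumption. }
  apply (real_trace_sum G (fun j t =>
    Q2R (b (Z.of_nat j - 1)%Z) * powerRZ t (Z.of_nat j - 1))).
  intros j. apply (real_trace_mult G (fun _ => Q2R _)); [apply real_trace_rat|].
  apply real_trace_powerRZ, Tid.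
Qed.

Theorem theorem1p15 :
  forall n : nat, (1 <= n)%nat ->
  exponential_period Q_t_expNt
    (RtoC (zeta (INR (2 * n + 1)) / PI ^ (2 * n))) /\
  forall b : Z -> Q, laurent_coefficients b ->
    exists I : R,
      is_RInt_gen
        (fun t : R =>
           1 / t ^ (2 * n)
           * (1 / (1 - exp (- t)) - laurent_partial_sum b (2 * n) t)
           * (exp (- t) / t))
        (at_right 0) (Rbar_locally p_infty) I /\
      zeta (INR (2 * n + 1)) / PI ^ (2 * n)
      = (-1) ^ n * 2 ^ (2 * n + 1) * (I + Q2R (c_const b n)).
Proof.
  intros n Hn. set (z := zeta (INR (2 * n + 1)) / PI ^ (2 * n)).
  assert (main : forall b, laurent_coefficients b -> exists I,
      is_RInt_gen
        (fun t => 1 / t ^ (2 * n)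
           * (1 / (1 - exp (- t)) - laurent_partial_sum b (2 * n) t) * (exp (- t) / t))
        (at_right 0) (Rbar_locally p_infty) I /\
      z = (-1) ^ n * 2 ^ (2 * n + 1) * (I + Q2R (c_const b n))).
  { intros b Hl. eexists. split; [apply is_RInt_gen_laurent; assumption|].
    assert (Hs : (-1) ^ n * (-1) ^ n = 1)
      by (rewrite <- Rpow_mult_distr; replace (-1 * -1) with 1 by ring; apply pow1).
    pose proof (pow_nonzero 2 (2 * n + 1) ltac:(lra)).
    pose proof (pow_nonzero PI (2 * n) PI_neq0). unfold z.
    transitivity ((-1) ^ n * (-1) ^ n * zeta (INR (2 * n + 1)) / PI ^ (2 * n)).
    - rewrite Hs. field. assumption.
    - field. split; assumption. }
  split; [|exact main].
  (* The period claim mentions no [b], so Laurent coefficients have to be produced. *)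
  destruct laurent_coefficients_exist as [b Hl].
  destruct (main b Hl) as (I & HI & E). rewrite E.
  apply (exponential_period_of_real_trace _ _ _
           (real_trace_laurent_integrand b n (c_const b n))).
  apply (is_RInt_gen_scal (V := R_NormedModule) _ ((-1) ^ n * 2 ^ (2 * n + 1))).
  (* The factor 1 is the integral of [exp (- t)]. *)
  rewrite <- (Rmult_1_r (Q2R (c_const b n))) at 1.
  apply (is_RInt_gen_plus (V := R_NormedModule) _ (fun t => Q2R (c_const b n) * exp (- t)));
    [exact HI|].
  apply (is_RInt_gen_scal (V := R_NormedModule) (fun t => exp (- t))).
  apply is_RInt_gen_exp_opp.
Qed.
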